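(* Let $n\ge 1$ and let $\overrightarrow{G}=([n],E)$ be a digraph with vertex set $[n]$ such that $X_{\overrightarrow{G}}(\mathbf{x},t)\in\Lambda_{\mathbb{Q}}[t]$, i.e. every coefficient of a power of $t$ in $X_{\overrightarrow{G}}(\mathbf{x},t)$ is a symmetric function. Let $G$ be the underlying undirected graph of $\overrightarrow{G}$. Then $$\omega X_{\overrightarrow{G}}(\mathbf{x},t)=\sum_{\lambda\vdash n}z_\lambda^{-1}p_\lambda\sum_{\sigma\in N_{G,\lambda}}t^{\mathrm{inv}_{\overrightarrow{G}}(\sigma)}.$$ Consequently, $\omega X_{\overrightarrow{G}}(\mathbf{x},t)$ is $p$-positive, i.e. the coefficient of each $p_\lambda$ in it is a polynomial in $t$ with nonnegative coefficients.
   Context: Digraphs are simple (no loops, no repeated directed edges); $(i,j)\in E$ is an edge directed from $i$ to $j$. The underlying undirected graph $G$ has an edge $\{i,j\}$ iff $(i,j)\in E$ or $(j,i)\in E$. A proper coloring of $\overrightarrow{G}$ is a map $\kappa:V\to\mathbb{P}=\{1,2,3,\dots\}$ with $\kappa(u)\ne\kappa(v)$ whenever $u,v$ are adjacent. Its ascent number is $\mathrm{asc}(\kappa)=|\{(u,v)\in E:\kappa(u)<\kappa(v)\}|$. The chromatic quasisymmetric function is $$X_{\overrightarrow{G}}(\mathbf{x},t)=\sum_{\kappa}t^{\mathrm{asc}(\kappa)}\prod_{v\in V}x_{\kappa(v)},$$ the sum over all proper colorings $\kappa$. $\Lambda_{\mathbb{Q}}$ is the $\mathbb{Q}$-algebra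 of symmetric functions in $x_1,x_2,\dots$; $\omega$ is its usual involution (exchanging $e_n$ and $h_n$), extended coefficientwise to $\Lambda_{\mathbb{Q}}[t]$; $p_\lambda$ are the power sum symmetric functions; $z_\lambda=\prod_i i^{m_i}m_i!$ where $m_i$ is the number of parts of $\lambda$ equal to $i$. For $\sigma=\sigma_1\cdots\sigma_n\in\mathfrak{S}_n$: $\mathrm{inv}_{\overrightarrow{G}}(\sigma)=|\{(i,j)\in E:\sigma^{-1}(j)<\sigma^{-1}(i)\}|$. For $x\in[n]$, $\mathrm{rank}_{(G,\sigma)}(x)$ is the length $k$ of the longest subword $\sigma_{i_1}\cdots\sigma_{i_k}$ with $i_1<\cdots<i_k$, $\sigma_{i_k}=x$, and $\{\sigma_{i_j},\sigma_{i_{j+1}}\}$ an edge of $G$ for each $1\le j<k$. $\sigma$ has a $G$-descent at $i$ ($1\le i\le n-1$) if either $\mathrm{rank}_{(G,\sigma)}(\sigma_i)>\mathrm{rank}_{(G,\sigma)}(\sigma_{i+1})$, or these ranks are equal and $\sigma_i>\sigma_{i+1}$. For a word $w=w_1\cdots w_k$ with distinct letters in $[n]$, a letter $w_j$ with $j>1$ is $G$-isolated if for all $i<j$ there is no edge of $G$ between $w_i$ and $w_j$. For a partition $\lambda=(\lambda_1\ge\cdots\ge\lambda_k)$ of $n$, $N_{G,\lambda}$ is the set of $\sigma\in\mathfrak{S}_n$ such that, when $\sigma$ is cut into contiguous segments $\alpha_1,\dots,\alpha_k$ of sizes $\lambda_1,\dots,\lambda_k$ in this order, each word $\alpha_i$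 has no $G$-isolated letters and contains no $G$-descent of $\sigma$ (that is, $\sigma$ has no $G$-descent at any $j$ for which $\sigma_j$ and $\sigma_{j+1}$ both lie in the same segment). *)

(* Defs.v *)
From HB Require Import structures.
From mathcomp Require Import all_boot all_order all_fingroup all_algebra finmap.
From mathcomp Require Import boolp functions.
From mathcomp Require Import monalg.

Set Implicit Arguments.
Unset Strict Implicit.
Unset Printing Implicit Defensive.

Import GRing.Theory.
Local Open Scope ring_scope.

Notation "1" := (@mone _) : monom_scope.
Notation "x * y" := (mmul x y) : monom_scope.
Notation "'U_(' i )" := (ucm i) : monom_scope.

(* A power series in x_0, x_1, x_2, ... over rat is the function giving the
   coefficient of each monomial.  Variables and colors are indexed by nat, so
   that i : nat stands for the positive integer i.+1. *)
Definition fpseries := {cmonom nat} -> rat.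

HB.instance Definition _ :=
  GRing.Lmodule.copy fpseries ({cmonom nat} -> rat^o).

Section Splits.
Implicit Types (m : {cmonom nat}) (ab : {cmonom nat} * {cmonom nat}).

(* All factorizations m = a * b: the exponents of a are at most mdeg m and
   vanish outside the support of m. *)
Definition splits m : seq ({cmonom nat} * {cmonom nat}) :=
  undup [seq ab : {cmonom nat} * {cmonom nat} <-
           [seq (let a := mkcmonom [fsfun i : finsupp m => (u i : nat) | 0%N] in
                 (a, divcm m a))
           | u : {ffun finsupp m -> 'I_(mdeg m).+1}]
        | (ab.1 * ab.2)%M == m].

Lemma splits_uniq m : uniq (splits m).
Proof. exact: undup_uniq. Qed.

Lemma leq_mdeg m i : (m i <= mdeg m)%N.
Proof.
rewrite mdegE; case: (mdomP m i) => // im.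
by rewrite (big_fsetD1 i) //= leq_addr.
Qed.

Lemma mem_splits m ab : (ab \in splits m) = ((ab.1 * ab.2)%M == m).
Proof.
rewrite mem_undup mem_filter; case: eqP => //= abm; case: ab abm => a b /= <-.
apply/mapP; exists [ffun i : finsupp (a * b)%M => inord (a (val i))].
  by rewrite mem_enum.
suff <- : a = mkcmonom [fsfun i : finsupp (a * b)%M =>
    ([ffun i : finsupp (a * b)%M => inord (a (val i))] i :
       'I_(mdeg (a * b)%M).+1) : nat | 0%N].
  by congr pair; apply/eqP/cmP => i; rewrite divcmE cmM addKn.
apply/eqP/cmP => i; rewrite cmE fsfun_ffun; case: insubP => [u _ <-|].
  by rewrite /= ffunE inordK // ltnS mdegM (leq_trans (leq_mdeg _ _)) ?leq_addr.
by rewrite /= -cmE_neq0 negbK cmM addn_eq0 => /andP[/eqP].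
Qed.

End Splits.

Section SeriesRing.
Implicit Types (f g h : fpseries) (m : {cmonom nat}).

Definition fps_one : fpseries := fun m => (m == 1%M)%:R.
Definition fps_mul f g : fpseries :=
  fun m => \sum_(ab <- splits m) f ab.1 * g ab.2.

Lemma fps_mulE f g m (s : seq ({cmonom nat} * {cmonom nat})) :
  uniq s -> (forall ab, (ab \in s) = ((ab.1 * ab.2)%M == m)) ->
  fps_mul f g m = \sum_(ab <- s) f ab.1 * g ab.2.
Proof.
move=> us ms; apply/perm_big/uniq_perm; rewrite ?splits_uniq //.
by move=> ab; rewrite ms mem_splits.
Qed.

Lemma fps_mulC : commutative fps_mul.
Proof.
move=> f g; apply/funext => m.
rewrite (@fps_mulE f g m [seq (ab.2, ab.1) | ab <- splits m]); last 2 first.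
- by rewrite map_inj_uniq ?splits_uniq // => -[a b] [c d] [-> ->].
- move=> [a b]; apply/mapP/idP => [[[c d]] + [-> ->]|abm] /=.
    by rewrite mem_splits mulmC.
  by exists (b, a); rewrite ?mem_splits //= mulmC.
by rewrite big_map /=; apply: eq_bigr => ab _; rewrite mulrC.
Qed.

Lemma fps_mul1 : left_id fps_one fps_mul.
Proof.
move=> f; apply/funext => m; rewrite /fps_mul.
have sm : (1%M, m) \in splits m by rewrite mem_splits mul1m.
rewrite (bigD1_seq _ sm) ?splits_uniq //= /fps_one eqxx mul1r big1_seq ?addr0 //.
move=> -[a b] /andP[]; rewrite mem_splits /=.
by case: (eqVneq a 1%M) => [->|_ _ _]; rewrite ?mul0r // mul1m => + /eqP bm;
  rewrite bm eqxx.
Qed.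

Lemma fps_mulDl : left_distributive fps_mul +%R.
Proof.
move=> f g h; apply/funext => m.
transitivity (\sum_(ab <- splits m) (f ab.1 * h ab.2 + g ab.1 * h ab.2)).
  by apply: eq_bigr => ab _; rewrite -mulrDl.
exact: big_split.
Qed.

Lemma fps_mulA : associative fps_mul.
Proof.
move=> f g h; apply/funext => m.
pose T := ({cmonom nat} * {cmonom nat} * {cmonom nat})%type.
pose F (t : T) := f t.1.1 * g t.1.2 * h t.2.
pose s1 : seq T := [seq (ab.1, cd.1, cd.2) | ab <- splits m, cd <- splits ab.2].
pose s2 : seq T := [seq (cd.1, cd.2, ab.2) | ab <- splits m, cd <- splits ab.1].
transitivity (\sum_(t <- s1) F t).
  rewrite /s1 big_allpairs_dep /fps_mul /=; apply: eq_bigr => ab _.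
  by rewrite mulr_sumr; apply: eq_bigr => cd _; rewrite mulrA.
transitivity (\sum_(t <- s2) F t); last first.
  rewrite /s2 big_allpairs_dep /fps_mul /=; apply: eq_bigr => ab _.
  by rewrite mulr_suml.
have m1 t : (t \in s1) = ((t.1.1 * t.1.2 * t.2)%M == m).
  apply/allpairsPdep/idP => [[ab [cd [+ + ->]]]|tm] /=.
    by rewrite !mem_splits -mulmA => + /eqP ->.
  exists (t.1.1, (t.1.2 * t.2)%M), (t.1.2, t.2).
  by rewrite !mem_splits /= mulmA; case: t tm => [[? ?] ?].
have m2 t : (t \in s2) = ((t.1.1 * t.1.2 * t.2)%M == m).
  apply/allpairsPdep/idP => [[ab [cd [+ + ->]]]|tm] /=.
    by rewrite !mem_splits => + /eqP ->.
  exists ((t.1.1 * t.1.2)%M, t.2), (t.1.1, t.1.2).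
  by rewrite !mem_splits /=; case: t tm => [[? ?] ?].
have eq12 : s1 =i s2 by move=> t; exact: etrans (m1 t) (esym (m2 t)).
apply: (perm_big s2); apply: uniq_perm eq12.
- apply: allpairs_uniq_dep => [|x _|]; [exact: splits_uniq..|].
  have in_dep (p : {_ & _}) : p \in [seq existT (fun=> _) ab cd
        | ab <- splits m, cd <- splits ab.2] ->
      (((tag p).1 * (tag p).2)%M == m) &&
      (((tagged p).1 * (tagged p).2)%M == (tag p).2).
    by move=> /allpairsPdep[ab [cd [+ + ->]]]; rewrite !mem_splits /= => -> ->.
  move=> [[a b] [c d]] [[a' b'] [c' d']] /in_dep h1 /in_dep h2.
  by move: h1 h2 => /= /andP[_ /eqP <-] /andP[_ /eqP <-] [-> -> ->].
- apply: allpairs_uniq_dep => [|x _|]; [exact: splits_uniq..|].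
  have in_dep (p : {_ & _}) : p \in [seq existT (fun=> _) ab cd
        | ab <- splits m, cd <- splits ab.1] ->
      (((tag p).1 * (tag p).2)%M == m) &&
      (((tagged p).1 * (tagged p).2)%M == (tag p).1).
    by move=> /allpairsPdep[ab [cd [+ + ->]]]; rewrite !mem_splits /= => -> ->.
  move=> [[a b] [c d]] [[a' b'] [c' d']] /in_dep h1 /in_dep h2.
  by move: h1 h2 => /= /andP[_ /eqP <-] /andP[_ /eqP <-] [-> -> ->].
Qed.

Lemma fps_one_neq0 : fps_one != 0.
Proof.
apply/eqP => /(congr1 (fun f : fpseries => f 1%M)) /eqP.
by rewrite /fps_one eqxx oner_eq0.
Qed.

End SeriesRing.

HB.instance Definition _ := GRing.Zmodule_isComNzRing.Build fpseries
  fps_mulA fps_mulC fps_mul1 fps_mulDl fps_one_neq0.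

Lemma fps_scaleAl (c : rat) (f g : fpseries) : c *: (f * g) = c *: f * g.
Proof.
apply/funext => m; transitivity (c * \sum_(ab <- splits m) f ab.1 * g ab.2) => //.
rewrite mulr_sumr.
by apply: eq_bigr => ab _; rewrite mulrA.
Qed.

HB.instance Definition _ :=
  GRing.Lmodule_isLalgebra.Build rat fpseries fps_scaleAl.

Lemma fps_scaleAr (c : rat) (f g : fpseries) : c *: (f * g) = f * (c *: g).
Proof. by rewrite mulrC fps_scaleAl mulrC. Qed.

HB.instance Definition _ :=
  GRing.Lalgebra_isAlgebra.Build rat fpseries fps_scaleAr.

Section SymmetricFunctions.
Implicit Types (f g : fpseries) (m : {cmonom nat}) (s t : nat -> nat).

(* m' is obtained from m by renaming each variable x_i into x_(s i). *)
Definition renames s m m' := forall i, m' (s i) = m i.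

Definition symmetric f :=
  forall s m m', bijective s -> renames s m m' -> f m' = f m.

Definition bounded_degree f :=
  exists d, forall m, (d < mdeg m)%N -> f m = 0.

Definition is_symfun : {pred fpseries} :=
  fun f => `[< symmetric f /\ bounded_degree f >].

Lemma is_symfunP f : reflect (symmetric f /\ bounded_degree f) (f \in is_symfun).
Proof. exact: asboolP. Qed.

Definition relabel t m : {cmonom nat} :=
  \big[mmul/mone]_(i <- finsupp m) (mkcmonom [fsfun j in fset1 (t i) => m i | 0%N]).

Lemma relabelP s m : bijective s -> renames s m (relabel s m).
Proof.
move=> /bij_inj sI j; rewrite /relabel.
rewrite (big_morph (fun m : {cmonom nat} => m (s j)) (cmM (s j)) (cm1 (s j))).
under eq_bigr => i _ do rewrite cmE fsfun_fun in_fset1 (inj_eq sI).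
case: (mdomP m j) => jm.
  rewrite (big_fsetD1 j) //= eqxx big1_seq ?addn0 // => i.
  by rewrite in_fsetD1 eq_sym => /and3P[_ /negPf ->].
rewrite big1_seq // => i /= im; case: eqP => // ji.
by move: jm; rewrite ji im.
Qed.

Lemma renames_inj s m1 m2 m : bijective s ->
  renames s m1 m -> renames s m2 m -> m1 = m2.
Proof. by move=> _ h1 h2; apply/eqP/cmP => i; rewrite -h1 -h2. Qed.

Lemma renames_fun s m m1 m2 : bijective s ->
  renames s m m1 -> renames s m m2 -> m1 = m2.
Proof.
move=> [t _ tK] h1 h2; apply/eqP/cmP => i.
by rewrite -(tK i) h1 h2.
Qed.

Lemma renamesM s a a' b b' :
  renames s a a' -> renames s b b' -> renames s (a * b)%M (a' * b')%M.
Proof. by move=> ha hb i; rewrite !cmM ha hb. Qed.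

Lemma renames_finsupp s m m' : bijective s -> renames s m m' ->
  perm_eq (finsupp m') (map s (finsupp m)).
Proof.
move=> sB h; have [t sK tK] := sB; apply: uniq_perm.
- exact: fset_uniq.
- by rewrite map_inj_uniq ?fset_uniq //; exact: bij_inj.
- move=> i; rewrite -(tK i) mem_map; last exact: bij_inj.
  by rewrite -!cmE_neq0 h.
Qed.

Lemma renames_mdeg s m m' : bijective s -> renames s m m' -> mdeg m' = mdeg m.
Proof.
move=> sB h; rewrite !mdegE (perm_big _ (renames_finsupp sB h)) big_map.
by apply: eq_bigr => i _; rewrite h.
Qed.

Lemma renames_has s m m' (a : pred nat) : bijective s -> renames s m m' ->
  has (fun i => a (m' i)) (finsupp m') = has (fun i => a (m i)) (finsupp m).
Proof.
move=> sB h; rewrite (perm_has _ (renames_finsupp sB h)) has_map.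
by apply: eq_has => i /=; rewrite h.
Qed.

Lemma is_symfun_closed : subalg_closed is_symfun.
Proof.
split=> [|c f g /is_symfunP[sf [d df]] /is_symfunP[sg [e eg]]|
          f g /is_symfunP[sf [d df]] /is_symfunP[sg [e eg]]]; apply/is_symfunP.
- split=> [s m m' sB h|].
    by congr (_%:R); rewrite -!mdeg_eq0 (renames_mdeg sB h).
  exists 0%N => m; rewrite lt0n mdeg_eq0 => /negPf m1.
  by transitivity ((m == 1%M)%:R : rat) => //; rewrite m1.
- split=> [s m m' sB h|].
    rewrite [LHS]/(c * f m' + g m') [RHS]/(c * f m + g m).
    by rewrite (sf _ _ _ sB h) (sg _ _ _ sB h).
  exists (maxn d e) => m; rewrite gtn_max => /andP[dm em].
  by rewrite [LHS]/(c * f m + g m) df // eg // mulr0.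
- split=> [s m m' sB h|].
    pose r (ab : {cmonom nat} * {cmonom nat}) := (relabel s ab.1, relabel s ab.2).
    have rB m0 := @relabelP s m0 sB.
    rewrite [LHS](@fps_mulE f g m' (map r (splits m))).
    + rewrite big_map /=; apply: eq_bigr => ab _ /=.
      by rewrite (sf _ _ _ sB (rB ab.1)) (sg _ _ _ sB (rB ab.2)).
    + rewrite map_inj_uniq ?splits_uniq // => -[a b] [a' b'] [ha hb].
      congr pair; apply: (renames_inj sB); first exact: rB.
      * by rewrite ha; exact: rB.
      * exact: rB.
      * by rewrite hb; exact: rB.
    + move=> [a b] /=; apply/mapP/eqP => [[[a0 b0]]|abm].
        rewrite mem_splits => /eqP /= abm [-> ->].
        by apply: (renames_fun sB _ h); rewrite -abm; exact: renamesM.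
      have [t sK tK] := sB.
      have tB : bijective t by exists s.
      have back m0 : relabel s (relabel t m0) = m0.
        by apply/eqP/cmP => i; rewrite -{1}(tK i) rB (relabelP _ tB).
      exists (relabel t a, relabel t b); last by rewrite /r /= !back.
      rewrite mem_splits /=; apply/eqP; apply: (renames_inj sB _ h).
      by rewrite -abm -{2}(back a) -{2}(back b); apply: renamesM; exact: rB.
  exists (d + e)%N => m dem; rewrite [LHS]/(fps_mul f g m) /fps_mul big1_seq //.
  move=> [a b] /=; rewrite mem_splits => /eqP /= abm.
  have : (d < mdeg a)%N || (e < mdeg b)%N.
    rewrite -[_ || _]negbK negb_or -!leqNgt; apply/negP => /andP[ad be].
    by move: dem; rewrite -abm mdegM ltnNge leq_add.
  by case/orP => [/df|/eg] ->; rewrite ?mul0r ?mulr0.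
Qed.

End SymmetricFunctions.

HB.instance Definition _ :=
  GRing.isSubalgClosed.Build rat fpseries is_symfun is_symfun_closed.

(* The algebra of symmetric functions with rational coefficients.  The
   involution omega is its only algebra endomorphism sending each sym_e k to
   sym_h k. *)
Record symfun := SymFun { fps_of : fpseries; _ : fps_of \in is_symfun }.

HB.instance Definition _ := [isSub for fps_of].
HB.instance Definition _ := [Choice of symfun by <:].
HB.instance Definition _ := [SubChoice_isSubComNzRing of symfun by <:].
HB.instance Definition _ := [SubZmodule_isSubLmodule of symfun by <:].
HB.instance Definition _ :=
  [SubNzRing_SubLmodule_isSubLalgebra of symfun by <:].
HB.instance Definition _ := [SubLalgebra_isSubAlgebra of symfun by <:].

Section Generators.
Variable k : nat.
Implicit Type m : {cmonom nat}.

Definition elem_fps : fpseries :=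
  fun m => ((mdeg m == k) && ~~ has (fun i => 1 < m i)%N (finsupp m))%:R.
Definition hom_fps : fpseries := fun m => (mdeg m == k)%:R.
(* The monomials x_i ^ k, for k > 0. *)
Definition psum_fps : fpseries :=
  fun m => ((mdeg m == k) && has (fun i => m i == k) (finsupp m))%:R.

Let sym_deg (a : pred nat) (b : bool -> bool) :
  (fun m => ((mdeg m == k) && b (has (fun i => a (m i)) (finsupp m)))%:R : rat)
    \in is_symfun.
Proof.
apply/is_symfunP; split=> [s m m' sB h|].
  by rewrite (renames_has _ sB h) (renames_mdeg sB h).
by exists k => m; case: eqP => [->|]; rewrite ?ltnn.
Qed.

Lemma elem_sym : elem_fps \in is_symfun.
Proof. exact: (sym_deg (fun e => 1 < e)%N negb). Qed.

Lemma hom_sym : hom_fps \in is_symfun.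
Proof.
suff -> : hom_fps = (fun m => ((mdeg m == k) && xpredT
    (has (fun i => xpredT (m i)) (finsupp m)))%:R).
  exact: (sym_deg xpredT xpredT).
by apply/funext => m; rewrite andbT.
Qed.

Lemma psum_sym : psum_fps \in is_symfun.
Proof. exact: (sym_deg (fun e => e == k) id). Qed.

Definition sym_e : symfun := SymFun elem_sym.
Definition sym_h : symfun := SymFun hom_sym.
Definition sym_p : symfun := SymFun psum_sym.

End Generators.

Definition is_intpart (n : nat) (la : seq nat) :=
  [&& sorted geq la, 0%N \notin la & sumn la == n].

(* A partition of n has at most n parts, each at most n. *)
Record intpart (n : nat) := IntPart {
  intpart_bseq : n.-bseq 'I_n.+1;
  _ : is_intpart n (map val intpart_bseq) }.

HB.instance Definition _ n := [isSub for @intpart_bseq n].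
HB.instance Definition _ n := [Finite of intpart n by <:].

Definition parts n (la : intpart n) : seq nat := map val (intpart_bseq la).

Definition zpart n (la : intpart n) : nat :=
  \prod_(1 <= i < n.+1)
    (i ^ count_mem i (parts la) * (count_mem i (parts la))`!).

Definition sym_p_part n (la : intpart n) : symfun :=
  \prod_(k <- parts la) sym_p k.

(* F is the sum of the sym_p_part la with coefficients c d la, polynomials in t,
   over all partitions la of all d; the family c has finite support. *)
Definition p_expansion (F : {poly symfun})
    (c : forall d, intpart d -> {poly rat}) :=
  exists2 D, (forall d (la : intpart d), (D <= d)%N -> c d la = 0)
    & F = \sum_(d < D) \sum_(la : intpart d)
            map_poly (fun a : rat => a *: sym_p_part la) (c d la).

Definition p_positive (F : {poly symfun}) :=
  exists c, [/\ p_expansion F c,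
    forall c', p_expansion F c' -> forall d (la : intpart d), c' d la = c d la
    & forall d (la : intpart d) k, 0 <= (c d la)`_k].

Section Digraphs.
Variables (n : nat) (E : rel 'I_n).

Definition edges : {set 'I_n * 'I_n} := [set e | E e.1 e.2].

Definition adj : rel 'I_n := fun u v => E u v || E v u.

Definition proper_coloring (c : 'I_n -> nat) :=
  [forall u, forall v, adj u v ==> (c u != c v)].

Definition asc (c : 'I_n -> nat) := #|[set e in edges | (c e.1 < c e.2)%N]|.

Definition coloring_monomial (c : 'I_n -> nat) : {cmonom nat} :=
  \big[mmul/mone]_v ucm (c v).

(* The coefficient of t ^ k.  A coloring with monomial m only uses colors from
   the finite support of m. *)
Definition chromatic_qsym_coef (k : nat) : fpseries := fun m =>
  #|[set c : {ffun 'I_n -> finsupp m} |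
      let c' := fun v => val (c v) in
      [&& proper_coloring c', asc c' == k & coloring_monomial c' == m]]|%:R.

Definition chromatic_qsym : {poly fpseries} :=
  \poly_(k < #|edges|.+1) chromatic_qsym_coef k.

Definition perm_word (s : 'S_n) : seq 'I_n := [seq s i | i <- enum 'I_n].

Definition Ginv (s : 'S_n) : nat :=
  #|[set e in edges | ((s^-1)%g e.2 < (s^-1)%g e.1)%N]|.

Definition Grank (s : 'S_n) (x : 'I_n) : nat :=
  \max_(w : n.-bseq 'I_n |
    [&& subseq w (perm_word s), sorted adj w, (w : seq 'I_n) != [::] & last x w == x])
  size w.

(* s has a G-descent at i iff Gdescent s holds of its letters at positions i
   and i.+1. *)
Definition Gdescent (s : 'S_n) : rel 'I_n := fun x y =>
  (Grank s y < Grank s x)%N || (Grank s x == Grank s y) && (y < x)%N.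

(* In a word w with distinct letters, the letter x is at position index x w,
   counted from 0. *)
Definition Gisolated (w : seq 'I_n) (x : 'I_n) :=
  [&& x \in w, (0 < index x w)%N & all (fun y => ~~ adj y x) (take (index x w) w)].

Definition Nset (la : intpart n) : {set 'S_n} :=
  [set s | all (fun w => ~~ has (Gisolated w) w
                      && sorted (fun x y => ~~ Gdescent s x y) w)
               (reshape (parts la) (perm_word s))].

End Digraphs.

(* Main.v *)
Require Import Defs.
From mathcomp Require Import all_boot all_order all_fingroup all_algebra finmap.
From mathcomp Require Import boolp monalg zify ring lra.

Set Implicit Arguments.
Unset Strict Implicit.
Unset Printing Implicit Defensive.

Import GRing.Theory Num.Theory.
Local Open Scope ring_scope.

(** Let pperp k be the adjoint of multiplication by p_k on symmetric functions.
    Applying it along the parts of la and taking the constant term gives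
    z_la times the coefficient of p_la, so it suffices to compute these numbers
    for the chromatic function, as omega p_la = psign la * p_la.  Sort the
    proper colorings by the acyclic orientation O that points to the smaller
    color: their generating function counts the ways of peeling off sets of
    sinks as color classes.  A sign-reversing involution, which moves a sink
    that is not a source in or out of the last color class, shows that pperp k
    amounts, up to sign, to removing a final set of k vertices with a unique
    source.  Writing each removed set as a word increasing for (rank, label)
    turns the removal sequences of type la into the permutations in Nset la
    inducing the orientation O. *)

(** * Coefficient functions of exponent sequences *)

(** The generating function of the colorings with one fixed orientation is in general not symmetric;
    only the sum over all orientations with the same number of reversed edges is. The adjoint of
    multiplication by p_k is therefore given by a formula that makes sense for every function of
    exponent sequences: taking the coefficient of x_0 ^ a is the adjoint of multiplication by h_a,
    and Newton's identity k h_k = p_1 h_(k-1) + ... + p_k h_0 yields the adjoints of the p_k from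
    these. The resulting [pperp] is linear on all functions, so pairings can be computed orientation
    by orientation, whereas commutation, the product rule and completeness of the pairings are
    proved for symmetric functions. Symmetry of X enters twice: in the expansion into power sums,
    and in reversing the order of the parts, since blocks are removed from the end of a word while
    [Nset] cuts it from the front. Sorting blocks by (rank, label) is consistent within one
    orientation because the rank of x is the length of a longest directed path ending in x: it
    depends only on the orientation and increases along arcs. *)

Section CoefficientFunctions.

Implicit Types (F G H : seq nat -> rat) (s t la : seq nat).

(* The coefficient of x_0 ^ a, as a series in the remaining variables. *)
Definition slice a F s := F (a :: s).

(* On symmetric functions this is the adjoint of multiplication by p_k,
   obtained by solving Newton's identity sliceN below; the first argument only
   bounds the depth of the recursion. *)
Fixpoint pperp_rec (d k : nat) F s : rat :=
  if d is d'.+1 then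
    k%:R * slice k F s - \sum_(1 <= j < k) pperp_rec d' j (slice (k - j) F) s
  else 0.

Definition pperp k := pperp_rec k k.

Lemma pperp_recE d k F s : (k <= d)%N -> pperp_rec d k F s = pperp k F s.
Proof.
rewrite /pperp; elim/ltn_ind: k d F s => k IH d F s.
case: d k IH => [|d] [|k] IH kd //=; first by rewrite mul0r big_geq ?subr0.
congr (_ - _); apply: eq_big_nat => j /andP[j0 jk].
by rewrite (IH j jk d) ?(IH j jk k) //; apply: (leq_trans jk kd).
Qed.

Lemma pperpE k F s : pperp k F s =
  k%:R * slice k F s - \sum_(1 <= j < k) pperp j (slice (k - j) F) s.
Proof.
rewrite {1}/pperp; case: k => [|k] /=; first by rewrite mul0r big_geq ?subr0.
by congr (_ - _); apply: eq_big_nat => j /andP[_ jk]; rewrite pperp_recE.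
Qed.

Lemma pperp0 F s : pperp 0 F s = 0. Proof. by []. Qed.

Lemma pperpP k c F G s :
  pperp k (fun s => c * F s + G s) s = c * pperp k F s + pperp k G s.
Proof.
elim/ltn_ind: k F G s => k IH F G s; rewrite pperpE [in RHS]pperpE.
rewrite [pperp k G s]pperpE /slice.
rewrite [X in _ - X](eq_big_nat _ _ (F2 := fun j =>
  c * pperp j (slice (k - j) F) s + pperp j (slice (k - j) G) s)); last first.
  by move=> j /andP[_ jk]; rewrite -IH.
by rewrite big_split -mulr_sumr /=; ring.
Qed.

Lemma pperp_zero k s : pperp k (fun=> 0) s = 0.
Proof.
have := pperpP k (-1) (fun=> 0) (fun=> 0) s.
by rewrite mulr0 addr0 => ->; ring.
Qed.

Lemma pperp_sum k (I : Type) (r : seq I) (P : pred I) (c : I -> rat)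
    (F : I -> seq nat -> rat) s :
  pperp k (fun s => \sum_(i <- r | P i) c i * F i s) s =
  \sum_(i <- r | P i) c i * pperp k (F i) s.
Proof.
elim: r s => [|i r IH] s.
  rewrite big_nil -[RHS](pperp_zero k s); congr (pperp k _ s).
  by apply/funext => t; rewrite big_nil.
rewrite big_cons -IH; case Pi: (P i).
  by rewrite -pperpP; congr (pperp k _ s); apply/funext => t; rewrite big_cons Pi.
by congr (pperp k _ s); apply/funext => t; rewrite big_cons Pi.
Qed.

Lemma sliceN k F s : slice 0 F = F ->
  \sum_(j < k.+1) pperp j (slice (k - j) F) s = k%:R * slice k F s.
Proof.
move=> F0; rewrite -(big_mkord xpredT (fun j => pperp j (slice (k - j) F) s)).
rewrite big_nat_recl // pperp0 add0r.
case: k => [|k]; first by rewrite big_geq ?mul0r.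
rewrite big_nat_recr //= subnn F0 pperpE.
rewrite big_add1 /=; ring.
Qed.

(** Zeros are discarded before comparing, so that [slice 0] becomes the identity; the term j = k of
    Newton's identity [sliceN] relies on this. *)
Definition zsym F := forall s t,
  perm_eq [seq x <- s | x != 0%N] [seq x <- t | x != 0%N] -> F s = F t.

Lemma slice_zsym a F : zsym F -> zsym (slice a F).
Proof. by move=> Fs s t st; apply: Fs => /=; case: ifP; rewrite ?perm_cons. Qed.

Lemma slice0 F : zsym F -> slice 0 F = F.
Proof. by move=> Fs; apply/funext => s; apply: Fs. Qed.

Lemma sliceC a b F : zsym F -> slice a (slice b F) = slice b (slice a F).
Proof.
move=> Fs; apply/funext => s; apply: Fs; apply/seq.permP => p /=.
by do 2!case: ifP => //= _; rewrite addnCA.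
Qed.

Lemma pperp_zsym k F : zsym F -> zsym (pperp k F).
Proof.
elim/ltn_ind: k F => k IH F Fs s t st; rewrite !pperpE.
rewrite (slice_zsym _ Fs st); congr (_ - _).
by apply: eq_big_nat => j /andP[_ jk]; apply: (IH) => //; apply: slice_zsym.
Qed.

Lemma pperp_slice k a F : zsym F -> pperp k (slice a F) = slice a (pperp k F).
Proof.
elim/ltn_ind: k F => k IH F Fs; apply/funext => s.
rewrite {2}/slice pperpE [in RHS]pperpE -/(slice k (slice a F) s) sliceC //.
congr (_ - _); apply: eq_big_nat => j /andP[_ jk].
by rewrite sliceC // IH //; apply: slice_zsym.
Qed.

(** On symmetric functions the slices commute with each other, hence with every [pperp k], which is
    a polynomial in slices. *)
Lemma pperpC j k F : zsym F -> pperp j (pperp k F) = pperp k (pperp j F).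
Proof.
elim/ltn_ind: j F => j IH F Fs; apply/funext => s.
rewrite [in LHS]pperpE -pperp_slice //.
have -> : pperp j F = (fun s => j%:R * slice j F s
    + \sum_(1 <= i < j) (- 1) * pperp i (slice (j - i) F) s).
  by apply/funext => t; rewrite pperpE -mulr_sumr mulN1r.
rewrite pperpP pperp_sum -mulr_sumr mulN1r; congr (_ - _).
by apply: eq_big_nat => i /andP[_ ij]; rewrite -pperp_slice // IH //; apply: slice_zsym.
Qed.

Fixpoint pairing la F : rat :=
  if la is k :: la' then pairing la' (pperp k F) else F [::].

Lemma pairing_sum la (I : Type) (r : seq I) (P : pred I) (c : I -> rat)
    (F : I -> seq nat -> rat) :
  pairing la (fun s => \sum_(i <- r | P i) c i * F i s) =
  \sum_(i <- r | P i) c i * pairing la (F i).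
Proof.
elim: la F => [//|k la IH] F /=; rewrite -IH; congr pairing.
by apply/funext => s; rewrite pperp_sum.
Qed.

Lemma pairingP la c F G :
  pairing la (fun s => c * F s + G s) = c * pairing la F + pairing la G.
Proof.
elim: la F G => [//|k la IH] F G /=; rewrite -IH; congr pairing.
by apply/funext => s; rewrite pperpP.
Qed.

Lemma pairing_zero la : pairing la (fun=> 0) = 0.
Proof.
have := pairingP la (-1) (fun=> 0) (fun=> 0).
by rewrite mulr0 addr0 => ->; ring.
Qed.

(** Commuting the [pperp]s brings any part to the front. This later allows the parts of a partition
    to be read backwards. *)
Lemma pairing_perm la mu F : zsym F -> perm_eq la mu ->
  pairing la F = pairing mu F.
Proof.
elim: la mu F => [|k la IH] mu F Fs.
  by move=> /perm_size/esym/size0nil ->.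
move=> pe; have kmu : k \in mu by rewrite -(perm_mem pe) mem_head.
have [mu1 [mu2 emu]] : exists mu1 mu2, mu = mu1 ++ k :: mu2.
  by case/splitPr: kmu => mu1 mu2; exists mu1, mu2.
subst mu.
have -> : pairing (mu1 ++ k :: mu2) F = pairing (k :: (mu1 ++ mu2)) F.
  elim: mu1 F Fs {pe kmu} => [//|j mu1 IHm] F Fs /=; rewrite IHm.
    by rewrite /= pperpC.
  exact: pperp_zsym.
apply: IH; first exact: pperp_zsym.
by rewrite -(perm_cons k) (perm_trans pe) // -cat1s perm_catCA.
Qed.

(* Newton's identity expresses every slice through lower ones and pperp, so
   that all coefficients are combinations of the pairings. *)
Lemma pairing_eq0 F : zsym F -> (forall la, pairing la F = 0) -> F = (fun=> 0).
Proof.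
move=> Fs F0; suff slice_ker k G : zsym G -> (forall la, pairing la G = 0) ->
    forall la, pairing la (slice k G) = 0.
  apply/funext => s; elim: s F Fs F0 => [|k s IH] F Fs F0; first exact: (F0 [::]).
  exact: (IH _ (slice_zsym k Fs) (slice_ker _ _ Fs F0)).
elim/ltn_ind: k G => -[|k] IH G Gs G0 la; first by rewrite slice0.
have k1 : k.+1%:R != 0 :> rat by rewrite pnatr_eq0.
apply: (mulfI k1); rewrite mulr0.
have -> : k.+1%:R * pairing la (slice k.+1 G) =
    pairing la (fun s => \sum_(j < k.+2) 1 * pperp j (slice (k.+1 - j) G) s).
  rewrite -[LHS]addr0 -[X in _ + X](pairing_zero la) -pairingP; congr pairing.
  apply/funext => s; under [RHS]eq_bigr do rewrite mul1r.
  by rewrite sliceN ?addr0 //; apply: slice0.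
rewrite pairing_sum big1 // => -[j ltj] _; rewrite mul1r.
case: j ltj => [|j] ltj.
  by rewrite -[RHS](pairing_zero la); congr pairing.

by apply: (IH _ _ G Gs G0 (j.+1 :: la)); rewrite /= subSS ltnS leq_subr.
Qed.

Definition homogeneous d F := forall s, sumn s != d -> F s = 0.

Lemma pperp_homogeneous k d F : homogeneous d F ->
  forall s, (k + sumn s)%N != d -> pperp k F s = 0.
Proof.
elim/ltn_ind: k d F => k IH d F Fd s ks; rewrite pperpE {1}/slice Fd // mulr0.
rewrite big_nat_cond big1 ?subr0 // => j /andP[/andP[_ jk] _].
have [kd|kd] := leqP (k - j) d; last first.
  have -> : slice (k - j) F = fun=> 0.
    apply/funext => t; apply: Fd => /=; apply: contraTneq kd => <-.
    by rewrite -leqNgt leq_addr.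
  exact: pperp_zero.
apply: (IH _ jk (d - (k - j))%N) => [t dt|]; first by apply: Fd => /=; lia.
lia.
Qed.

Lemma pairing_homogeneous la d F : homogeneous d F -> sumn la != d ->
  pairing la F = 0.
Proof.
elim: la d F => [|k la IH] d F Fd /= lad; first by apply: Fd.
have [kd|kd] := leqP k d.
  apply: (IH (d - k)%N) => [s sd|]; last lia.
  by apply: (pperp_homogeneous Fd); lia.
rewrite -[RHS](pairing_zero la); congr pairing; apply/funext => s.
by apply: (pperp_homogeneous Fd); lia.
Qed.

End CoefficientFunctions.

(** * Products of coefficient functions *)

Section SplitProduct.

Implicit Types (F G H : seq nat -> rat) (s t la : seq nat).

Fixpoint seqsplits s : seq (seq nat * seq nat) :=
  if s is a :: s' then
    [seq (b :: u.1, (a - b)%N :: u.2) | b <- iota 0 a.+1, u <- seqsplits s']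
  else [:: ([::], [::])].

Definition smul F G s := \sum_(u <- seqsplits s) F u.1 * G u.2.

Lemma slice_smul a F G s :
  slice a (smul F G) s = \sum_(b < a.+1) smul (slice b F) (slice (a - b) G) s.
Proof.
rewrite /slice /smul -[seqsplits (a :: s)]/(allpairs_dep
  (fun b u => (b :: u.1, (a - b)%N :: u.2)) (iota 0 a.+1) (fun=> seqsplits s)).
rewrite big_allpairs_dep.
by rewrite -(big_mkord xpredT (fun b => \sum_(u <- seqsplits s)
  F (b :: u.1) * G ((a - b)%N :: u.2))).
Qed.

Lemma smulC F G s : smul F G s = smul G F s.
Proof.
elim: s F G => [|a s IH] F G; first by rewrite /smul !big_seq1 mulrC.
rewrite -/(slice a (smul F G) s) -/(slice a (smul G F) s) !slice_smul.
rewrite (reindex_inj rev_ord_inj) /=; apply: eq_bigr => b _.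
by rewrite IH subSS subKn // -ltnS.
Qed.

Lemma smul_suml F G (I : Type) (r : seq I) (P : pred I) (c : I -> rat)
    (H : I -> seq nat -> rat) s :
  smul (fun s => \sum_(i <- r | P i) c i * H i s) G s =
  \sum_(i <- r | P i) c i * smul (H i) G s.
Proof.
rewrite /smul; under [RHS]eq_bigr do rewrite mulr_sumr.
rewrite exchange_big; apply: eq_bigr => u _ /=; rewrite mulr_suml.
by apply: eq_bigr => i _; rewrite mulrA.
Qed.

Lemma smulZl c F G s : smul (fun s => c * F s) G s = c * smul F G s.
Proof. by rewrite /smul mulr_sumr; apply: eq_bigr => u _; rewrite mulrA. Qed.

Lemma triangle_sum (V : nmodType) k (f : nat -> nat -> V) :
  \sum_(j < k.+1) \sum_(b < (k - j).+1) f j b =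
  \sum_(b < k.+1) \sum_(j < (k - b).+1) f j b.
Proof.
have widen (g : nat -> V) (j : 'I_k.+1) :
    \sum_(b < (k - j).+1) g b = \sum_(b < k.+1 | (j + b <= k)%N) g b.
  rewrite (big_ord_widen k.+1 (fun i => g i)) ?ltnS ?leq_subr //; apply: eq_bigl => b.
  by rewrite ltnS; move: (ltn_ord j); rewrite ltnS => jk; rewrite leq_subRL.
under eq_bigr => j _ do rewrite (widen (f j)).
under [RHS]eq_bigr => b _ do rewrite (widen (f^~ b)).
rewrite (exchange_big_dep xpredT) //=; apply: eq_bigr => b _.
by apply: eq_bigl => j; rewrite addnC.
Qed.

(** Group the terms by c = j + b. The right factor is then constant, and the left factors add up by
    Newton's identity [sliceN] at c. *)
Lemma smul_newton k F G s : slice 0 F = F ->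
  \sum_(j < k.+1) \sum_(b < (k - j).+1)
     smul (pperp j (slice b F)) (slice (k - j - b) G) s =
  \sum_(c < k.+1) c%:R * smul (slice c F) (slice (k - c) G) s.
Proof.
move=> F0.
under eq_bigr => j _.
  rewrite (reindex_inj rev_ord_inj) /=.
  under eq_bigr => b _ do rewrite subSS (subKn (ltn_ord b : (b <= _)%N)).
  over.
rewrite (triangle_sum k (fun j b => smul (pperp j (slice (k - j - b) F)) (slice b G) s)).
rewrite (reindex_inj rev_ord_inj) /=; apply: eq_bigr => c _.
rewrite subSS (subKn (ltn_ord c : (c <= _)%N)) -smulZl.
under eq_bigr => j _.
  rewrite subnAC (subKn (ltn_ord c : (c <= _)%N)).
  rewrite -[smul _ _ _]mul1r.
  over.
rewrite -smul_suml //; congr (smul _ _ s); apply/funext => t.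
under eq_bigr do rewrite mul1r.
by rewrite sliceN.
Qed.

(** The adjoint of a primitive element is a derivation. Newton's identity for the product is
    compared with the sum of [smul_newton] for both factors: by induction the terms below the top
    one agree, so the top ones do. *)
Lemma pperp_smul k F G s : zsym F -> zsym G ->
  pperp k (smul F G) s = smul (pperp k F) G s + smul F (pperp k G) s.
Proof.
elim/ltn_ind: k F G s => -[|k] IH F G s Fs Gs.
  by rewrite /smul !big1 ?addr0 // => u _; rewrite ?mul0r ?mulr0.
have FG0 : slice 0 (smul F G) = smul F G.
  apply/funext => t; rewrite slice_smul big_ord1 subnn.
  by rewrite !slice0.
have := sliceN k.+1 s FG0; rewrite big_ord_recr /= subnn FG0 slice_smul.
have := smul_newton k.+1 G s (slice0 Fs).
have := smul_newton k.+1 F s (slice0 Gs).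
rewrite big_ord_recr /= subnn big_ord1 subn0 (slice0 Fs) (slice0 Gs) => nG.
rewrite big_ord_recr /= subnn big_ord1 subn0 (slice0 Fs) (slice0 Gs) => nF nFG.
(* After replacing c by k.+1 - c in the second sum, the two weights of each product add up to
   k.+1. *)
have tot : \sum_(c < k.+2) c%:R * smul (slice c F) (slice (k.+1 - c) G) s +
   \sum_(c < k.+2) c%:R * smul (slice c G) (slice (k.+1 - c) F) s =
   k.+1%:R * \sum_(c < k.+2) smul (slice c F) (slice (k.+1 - c) G) s.
  rewrite [X in _ + X](reindex_inj rev_ord_inj) /= -big_split mulr_sumr /=.
  apply: eq_bigr => c _; have ck : (c <= k.+1)%N by rewrite -ltnS.
  by rewrite subSS subKn // [X in _ + _ * X]smulC -mulrDl -natrD subnKC.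
move: nFG; rewrite -tot -nF -nG.
have -> : \sum_(j < k.+1) pperp j (slice (k.+1 - j) (smul F G)) s =
   \sum_(j < k.+1) \sum_(b < (k.+1 - j).+1)
      smul (pperp j (slice b F)) (slice (k.+1 - j - b) G) s +
   \sum_(j < k.+1) \sum_(b < (k.+1 - j).+1)
      smul (pperp j (slice b G)) (slice (k.+1 - j - b) F) s.
  rewrite -big_split; apply: eq_bigr => j _ /=.
  have -> : slice (k.+1 - j) (smul F G) = fun s =>
      \sum_(b < (k.+1 - j).+1) 1 * smul (slice b F) (slice (k.+1 - j - b) G) s.
    by apply/funext => t; rewrite slice_smul; under [RHS]eq_bigr do rewrite mul1r.
  rewrite pperp_sum [X in _ + X](reindex_inj rev_ord_inj) -big_split.
  apply: eq_bigr => b _ /=; rewrite mul1r IH //; try exact: slice_zsym.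
  by rewrite subSS (subKn (ltn_ord b : (b <= _)%N)) [X in _ + X]smulC.
by rewrite (smulC F (pperp _ G)) => h; lra.
Qed.

End SplitProduct.

(** * Symmetric functions through exponent sequences *)

Section ExponentSequences.

Implicit Types (s t : seq nat) (m : {cmonom nat}) (f g : fpseries).

Definition mon s : {cmonom nat} :=
  mkcmonom [fsfun i in seq_fset tt (iota 0 (size s)) => nth 0%N s i | 0%N].

Lemma monE s i : mon s i = nth 0%N s i.
Proof.
rewrite cmE fsfun_fun seq_fsetE mem_iota leq0n add0n /=.
by case: ltnP => // h; rewrite nth_default.
Qed.

Lemma mon_exists m : exists s, m = mon s.
Proof.
pose N := (\max_(i <- finsupp m) i).+1.
exists (mkseq m N); apply/eqP/cmP => i; rewrite monE.
have [iN|iN] := ltnP i N; first by rewrite nth_mkseq.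
rewrite nth_default ?size_mkseq //; apply/eqP; rewrite cmE_eq0.
by apply: contraL iN => im; rewrite -ltnNge ltnS (leq_bigmax_seq _ im).
Qed.

Definition evs f : seq nat -> rat := fun s => f (mon s).

Lemma evs_inj : injective evs.
Proof.
move=> f g fg; apply/funext => m; have [s ->] := mon_exists m.
exact: (congr1 (fun h => h s) fg).
Qed.

Lemma mem_finsupp_mon s i : (i \in finsupp (mon s)) = (nth 0%N s i != 0%N).
Proof. by rewrite -cmE_neq0 monE. Qed.

Lemma has_mon s (a : pred nat) : ~~ a 0%N ->
  has (fun i => a (mon s i)) (finsupp (mon s)) = has a s.
Proof.
move=> a0; apply/hasP/hasP => [[i _ ai]|[x /(nthP 0%N)[i si <-] ax]].
  exists (mon s i) => //; rewrite monE in ai *.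
  have [h|h] := ltnP i (size s); first exact: mem_nth.
  by move: ai; rewrite nth_default // (negPf a0).
exists i; last by rewrite monE.
by rewrite mem_finsupp_mon; apply: contraNneq a0 => <-.
Qed.

Lemma mdeg_mon s : mdeg (mon s) = sumn s.
Proof.
rewrite mdegE sumnE (big_nth 0%N) big_mkord.
rewrite -(big_mkord xpredT (fun i => nth 0%N s i)) /index_iota subn0.
rewrite [RHS](bigID (fun i => i \in finsupp (mon s))) /= [X in (_ + X)%N]big1.
  under eq_bigr do rewrite monE.
  rewrite addn0 -[RHS]big_filter; apply: perm_big; apply: uniq_perm;
    rewrite ?fset_uniq ?filter_uniq ?iota_uniq //.
  move=> i; rewrite mem_filter mem_iota /= add0n.
  have [//|/= si] := ltnP i (size s); first by rewrite andbT.
  by rewrite andbF mem_finsupp_mon nth_default.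
by move=> i; rewrite mem_finsupp_mon negbK => /eqP.
Qed.

Lemma evsM f g : evs (f * g) = smul (evs f) (evs g).
Proof.
apply/funext => s; rewrite /smul.
have sz u : u \in seqsplits s -> size u.1 = size s /\ size u.2 = size s.
  elim: s u => [|a s IH] u; first by rewrite inE => /eqP ->.
  by move=> /allpairsP[[b v] [_ /IH /= [h1 h2] ->]] /=; rewrite h1 h2.
have us : uniq (seqsplits s).
  elim: s {sz} => [//|a s IH]; apply: allpairs_uniq; rewrite ?iota_uniq //.
  by move=> [b [u v]] [b' [u' v']] _ _ [-> -> _ ->].
rewrite [LHS](@fps_mulE f g _ [seq (mon u.1, mon u.2) | u <- seqsplits s]).
- by rewrite big_map.
- rewrite map_inj_in_uniq // => u v /sz[u1 u2] /sz[v1 v2] [e1 e2].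
  have E x y : size x = size s -> size y = size s -> mon x = mon y -> x = y.
    move=> hx hy e; apply: (@eq_from_nth _ 0%N); rewrite ?hx ?hy // => i _.
    by rewrite -!monE e.
  by rewrite (surjective_pairing u) (surjective_pairing v) (E _ _ u1 v1 e1) (E _ _ u2 v2 e2).
move=> [m1 m2] /=; apply/mapP/eqP => [[u us' [-> ->]]|e].
  apply/eqP/cmP => i; rewrite cmM !monE.
  elim: s u us' i {us sz} => [|a s IH] u; first by rewrite inE => /eqP -> i; rewrite nth_nil.
  move=> /allpairsP[[b v] [+ hv ->]]; rewrite mem_iota add0n ltnS /= in hv * => ba.
  by case=> [|i] /=; [rewrite subnKC | apply: IH].
have e' i : (m1 i + m2 i = nth 0 s i)%N by rewrite -cmM e monE.
exists (mkseq m1 (size s), mkseq m2 (size s)); last first.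
  have E m : (forall i, m i <= nth 0%N s i)%N -> m = mon (mkseq m (size s)).
    move=> le; apply/eqP/cmP => i; rewrite monE.
    have [h|h] := ltnP i (size s); first by rewrite nth_mkseq.
    rewrite nth_default ?size_mkseq //; apply/eqP; rewrite -leqn0.
    by rewrite (leq_trans (le i)) // nth_default.
  by congr pair; apply: E => i; rewrite -e' ?leq_addr ?leq_addl.
move: (m1 : nat -> nat) (m2 : nat -> nat) e' => a1 a2 {us sz e}.
elim: s a1 a2 => [//|a s IH] a1 a2 e.
have e0 : (a1 0 + a2 0 = a)%N := e 0%N.
apply/allpairsP; exists (a1 0%N, (mkseq (a1 \o S) (size s), mkseq (a2 \o S) (size s))).
split.
- by rewrite mem_iota add0n ltnS /= -e0 leq_addr.
- by apply: (IH (a1 \o S) (a2 \o S)) => i; rewrite /= (e i.+1).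
rewrite /= -e0 addKn /mkseq /=; congr (_ :: _, _ :: _);
  by rewrite (iotaDl 1 0) -map_comp.
Qed.

(** Padded with zeros to a common length, the two sequences are permutations of each other, and a
    permutation of the positions extends to a renaming of all variables. *)
Lemma evs_zsym f : f \in is_symfun -> zsym (evs f).
Proof.
move=> /is_symfunP[fs _] s t st.
pose N := (size s + size t)%N.
pose s' := s ++ nseq (N - size s) 0%N.
pose t' := t ++ nseq (N - size t) 0%N.
have ss' : size s' = N by rewrite size_cat size_nseq subnKC ?leq_addr.
have st' : size t' = N by rewrite size_cat size_nseq subnKC ?leq_addl.
have padE u k i : nth 0%N (u ++ nseq k 0%N) i = nth 0%N u i.
  rewrite nth_cat; case: ltnP => // h.
  by rewrite nth_nseq if_same nth_default.
have pst : perm_eq s' t'.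
  have E u k : perm_eq (u ++ nseq k 0%N)
      ([seq x <- u | x != 0%N] ++ nseq (size u + k - size [seq x <- u | x != 0%N]) 0%N).
    have -> : (size u + k - size [seq x <- u | x != 0] = count_mem 0 u + k)%N.
      have <- : (count_mem 0 u + count (fun x => x != 0) u = size u)%N.
        exact: (count_predC (pred1 0%N) u).
      by rewrite size_filter addnAC addnK.
    rewrite nseqD catA perm_cat2r.
    have -> : nseq (count_mem 0%N u) 0%N = [seq x <- u | ~~ (x != 0%N)].
      have /all_pred1P e : all (pred1 0%N) [seq x <- u | ~~ (x != 0%N)].
        by rewrite all_filter; apply/allP => x _ /=; rewrite negbK implybb.
      by rewrite [RHS]e size_filter; congr nseq; apply: eq_count => x /=; rewrite negbK.
    by rewrite perm_sym perm_filterC.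
  apply: (perm_trans (E _ _)); rewrite perm_sym; apply: (perm_trans (E _ _)).
  rewrite -/N !subnKC ?leq_addl ?leq_addr // (perm_size st).
  by rewrite perm_sym perm_cat2r.
move: pst; rewrite perm_sym => /(perm_iotaP 0%N)[p pi tE].
have sp : size p = N by rewrite (perm_size pi) size_iota.
have up : uniq p by rewrite (perm_uniq pi) iota_uniq.
have mp i : (i \in p) = (i < N)%N by rewrite (perm_mem pi) mem_iota ss'.
(* The default value i makes [sg] the identity beyond N, hence a bijection of all natural
   numbers. *)
pose sg i := nth i p i.
apply: (fs sg).
  exists (fun j => if j \in p then index j p else j) => i.
    rewrite /sg; have [h|h] := ltnP i N.
      by rewrite mem_nth ?sp // index_uniq ?sp.
    by rewrite nth_default ?sp // mp ltnNge h.
  rewrite /sg; case: ifP => [h|]; first by rewrite nth_index.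
  by move=> /negbT; rewrite mp -leqNgt => h; rewrite nth_default ?sp.
move=> i; rewrite !monE -(padE s (N - size s)%N) -(padE t (N - size t)%N) -/s' -/t'.
rewrite tE /sg; have [h|h] := ltnP i N.
  by rewrite (nth_map 0%N) ?sp // (set_nth_default 0%N) // sp.
by rewrite !nth_default ?size_map ?sp ?ss'.
Qed.

Lemma evsP (c : rat) f g : evs (c *: f + g) = fun s => c * evs f s + evs g s.
Proof. by []. Qed.

Lemma evs_sum (I : Type) (r : seq I) (P : pred I) (c : I -> rat) (F : I -> fpseries) :
  evs (\sum_(i <- r | P i) c i *: F i) = fun s => \sum_(i <- r | P i) c i * evs (F i) s.
Proof.
apply/funext => s; elim: r => [|i r IH]; first by rewrite !big_nil.
rewrite !big_cons; case: ifP => // _.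
by rewrite evsP IH.
Qed.

Lemma evs1 s : evs 1 s = (all (pred1 0%N) s)%:R.
Proof.
rewrite -[LHS]/((mon s == 1%M)%:R) -mdeg_eq0 mdeg_mon; congr (nat_of_bool _)%:R.
by elim: s => //= x s IH; rewrite addn_eq0 IH.
Qed.

Lemma evs_h k s : evs (hom_fps k) s = (sumn s == k)%:R.
Proof. by rewrite /evs /hom_fps mdeg_mon. Qed.

Lemma evs_e k s : evs (elem_fps k) s = ((sumn s == k) && all (leq^~ 1%N) s)%:R.
Proof.
rewrite /evs /elem_fps mdeg_mon has_mon // -all_predC; congr (nat_of_bool (_ && _))%:R.
by apply: eq_all => x /=; rewrite [RHS]leqNgt.
Qed.

Lemma evs_p k s : (0 < k)%N -> evs (psum_fps k) s = ((sumn s == k) && (k \in s))%:R.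
Proof.
move=> k0; rewrite /evs /psum_fps mdeg_mon (has_mon _ (a := pred1 k)) ?has_pred1 //=.
by rewrite eq_sym -lt0n.
Qed.

End ExponentSequences.

(** * Power sum expansions *)

Section PowerSums.

Implicit Types (s la mu : seq nat) (f : symfun).

Lemma pperpZ k c F s : pperp k (fun s => c * F s) s = c * pperp k F s.
Proof.
rewrite -[RHS]addr0 -[X in _ + X](pperp_zero k s) -pperpP.
by congr (pperp k _ s); apply/funext => t; rewrite addr0.
Qed.

Lemma slice_evs1 a : (0 < a)%N -> slice a (evs 1) = fun=> 0.
Proof. by case: a => // a _; apply/funext => s; rewrite /slice evs1. Qed.

Lemma pperp_evs1 k s : pperp k (evs 1) s = 0.
Proof.
case: k => [//|k]; rewrite pperpE slice_evs1 // mulr0 big_nat_cond big1 ?subr0 // => j.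
by move=> /andP[/andP[_ jk] _]; rewrite slice_evs1 ?subn_gt0 // pperp_zero.
Qed.

Lemma slice_psum a j : (0 < a)%N -> (0 < j)%N ->
  slice a (evs (psum_fps j)) = fun s => (a == j)%:R * evs 1 s.
Proof.
move=> a0 j0; apply/funext => s; rewrite /slice evs_p // evs1 /= inE.
have -> : all (pred1 0%N) s = (sumn s == 0%N).
  by elim: s => //= x s ->; rewrite addn_eq0.
rewrite -natrM mulnb; congr (nat_of_bool _)%:R; rewrite [j == a]eq_sym.
case: (eqVneq a j) => [->|aj] /=; first by rewrite -{2}(addn0 j) eqn_add2l andbT.
apply/negP => /andP[/eqP sj js].
have : (j <= sumn s)%N by rewrite sumnE (big_rem _ js) leq_addr.
lia.
Qed.

Lemma pperp_psum j k s : (0 < j)%N ->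
  pperp k (evs (psum_fps j)) s = (k * (k == j))%:R * evs 1 s.
Proof.
move=> j0; case: k => [|k]; first by rewrite pperp0 mul0n mul0r.
rewrite pperpE slice_psum // natrM mulrA big_nat_cond big1 ?subr0 // => i.
move=> /andP[/andP[_ ik] _]; rewrite slice_psum ?subn_gt0 //.
by rewrite pperpZ pperp_evs1 mulr0.
Qed.

Definition symcf f : seq nat -> rat := evs (val f).

Lemma symcf_zsym f : zsym (symcf f).
Proof. exact/evs_zsym/valP. Qed.

Lemma symcf_inj : injective symcf.
Proof. by move=> f g /evs_inj/val_inj. Qed.

Lemma symcfM f g : symcf (f * g) = smul (symcf f) (symcf g).
Proof. by rewrite /symcf rmorphM evsM. Qed.

Lemma symcf_sum (I : Type) (r : seq I) (P : pred I) (c : I -> rat) (F : I -> symfun) :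
  symcf (\sum_(i <- r | P i) c i *: F i) =
  fun s => \sum_(i <- r | P i) c i * symcf (F i) s.
Proof.
rewrite /symcf linear_sum; under eq_bigr do rewrite linearZ.
exact: evs_sum.
Qed.

Definition sym_p_seq mu : symfun := \prod_(k <- mu) sym_p k.

Lemma symcf_p_cons k mu :
  symcf (sym_p_seq (k :: mu)) = smul (evs (psum_fps k)) (symcf (sym_p_seq mu)).
Proof. by rewrite /sym_p_seq big_cons symcfM. Qed.

Lemma smul1 F s : smul (evs 1) F s = F s.
Proof.
elim: s F => [|a s IH] F; first by rewrite /smul big_seq1 evs1 mul1r.
rewrite -/(slice a (smul (evs 1) F) s) slice_smul big_ord_recl /= subn0.
rewrite slice0 ?IH ?big1 ?addr0 // => [i _|].
  rewrite slice_evs1 // /smul big1 // => u _; exact: mul0r.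
by apply: (evs_zsym (rpred1 _)).
Qed.

(** By the product rule, [pperp k] acts on products of power sums as k times the derivative in p_k.
    If k is not a part, the count is 0 and the value of [rem] is irrelevant. *)
Lemma pperp_p k mu s : 0%N \notin mu ->
  pperp k (symcf (sym_p_seq mu)) s =
  (k * count_mem k mu)%:R * symcf (sym_p_seq (rem k mu)) s.
Proof.
elim: mu s => [|j mu IH] s; rewrite ?inE ?negb_or.
  move=> _; rewrite /sym_p_seq big_nil muln0 mul0r -[RHS](pperp_evs1 k s).
  by congr (pperp k _ s); rewrite /symcf rmorph1.
move=> /andP[j0 mu0]; rewrite symcf_p_cons pperp_smul; last 2 first.
- exact: (symcf_zsym (sym_p j)).
- exact: symcf_zsym.
have -> : pperp k (evs (psum_fps j)) = fun t => (k * (k == j))%:R * evs 1 t.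
  by apply/funext => t; rewrite pperp_psum // lt0n eq_sym.
have -> : pperp k (symcf (sym_p_seq mu)) =
    fun t => (k * count_mem k mu)%:R * symcf (sym_p_seq (rem k mu)) t.
  by apply/funext => t; rewrite IH.
rewrite smulZl smul1 [smul (evs _) _ s]smulC smulZl smulC -symcf_p_cons /=.
case: (eqVneq j k) => [->|jk].
  rewrite muln1 mulnDr natrD mulrDl muln1; congr (_ + _).
  have [kmu|kmu] := boolP (k \in mu); last by rewrite (count_memPn kmu) muln0 !mul0r.
  congr (_ * symcf _ s); rewrite /sym_p_seq; apply: perm_big.
  by rewrite perm_sym perm_to_rem.
by rewrite muln0 mul0r add0r add0n.
Qed.

(** This is z_la, built up in the order in which [pairing] consumes the parts: the m copies of k
    contribute k * m, k * (m - 1), ..., k * 1. *)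
Fixpoint zseq la : nat :=
  if la is k :: la' then k * (count_mem k la').+1 * zseq la' else 1.

Lemma pairing_mulc la c F : pairing la (fun s => c * F s) = c * pairing la F.
Proof.
rewrite -[RHS]addr0 -[X in _ + X](pairing_zero la) -pairingP.
by congr pairing; apply/funext => s; rewrite addr0.
Qed.

(** Orthogonality of the power sums for the Hall inner product: each step of [pairing]
    differentiates away one part of mu. *)
Lemma pairing_p la mu : 0%N \notin mu ->
  pairing la (symcf (sym_p_seq mu)) = (zseq la * perm_eq la mu)%:R.
Proof.
elim: la mu => [|k la IH] mu mu0.
  case: mu mu0 => [|j mu]; first by rewrite /sym_p_seq big_nil /= /symcf rmorph1 evs1.
  rewrite inE negb_or => /andP[j0 _]; rewrite [LHS]/= symcf_p_cons /smul big_seq1.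
  rewrite evs_p ?lt0n 1?eq_sym // in_nil andbF mul0r.
  by rewrite (_ : perm_eq [::] _ = false) //; apply/negP => /perm_size.
rewrite /=; have -> : pperp k (symcf (sym_p_seq mu)) =
    fun t => (k * count_mem k mu)%:R * symcf (sym_p_seq (rem k mu)) t.
  by apply/funext => t; rewrite pperp_p.
rewrite pairing_mulc IH; last by apply: contra mu0; apply: mem_rem.
rewrite -natrM; congr (_%:R).
have [kmu|kmu] := boolP (k \in mu); last first.
  rewrite (count_memPn kmu) muln0 mul0n.
  case: (boolP (perm_eq _ _)) => [pe|_]; last by rewrite muln0.
  by move: kmu; rewrite -(perm_mem pe) mem_head.
have -> : perm_eq (k :: la) mu = perm_eq la (rem k mu).
  by rewrite -[RHS](perm_cons k); apply: (permPr (perm_to_rem kmu)).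
case: (boolP (perm_eq la _)) => [pe|_]; last by rewrite !muln0.
rewrite !muln1; congr (_ * _ * _)%N.
have /seq.permP -> := perm_to_rem kmu; rewrite /= eqxx add1n.
by congr _.+1; apply/esym; move/seq.permP: pe; apply.
Qed.

Lemma pairing0 la F : 0%N \in la -> pairing la F = 0.
Proof.
elim: la F => [//|k la IH] F; rewrite inE /= => /orP[/eqP <-|/IH -> //].
by rewrite -[RHS](pairing_zero la); congr pairing.
Qed.

Lemma p_homogeneous mu : 0%N \notin mu -> homogeneous (sumn mu) (symcf (sym_p_seq mu)).
Proof.
elim: mu => [|j mu IH] mu0 s.
  rewrite /= /sym_p_seq big_nil /symcf rmorph1 evs1 => s0.
  by case: allP => // h; case/eqP: s0; elim: s h => //= x s IHs h;
    rewrite (eqP (h x _)) ?mem_head ?IHs // => y ys; rewrite h // inE ys orbT.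
move: mu0; rewrite inE negb_or => /andP[j0 mu0] /= sj; rewrite symcf_p_cons /smul.
have sz u : u \in seqsplits s -> (sumn u.1 + sumn u.2 = sumn s)%N.
  elim: s u {sj} => [|a s IHs] u; first by rewrite inE => /eqP ->.
  move=> /allpairsP[[b v] [+ /IHs /= <- ->]].
  by rewrite mem_iota add0n ltnS /=; lia.
rewrite big_seq big1 // => u /sz us.
rewrite evs_p ?lt0n 1?eq_sym //.
case: eqP => [u1|]; last by rewrite mul0r.
by rewrite IH ?mulr0 //; apply: contraNneq sj => <-; rewrite -us u1.
Qed.

End PowerSums.

(** * Partitions and the power sum basis *)

Section Partitions.

Variable n : nat.
Implicit Types (la mu : intpart n) (s : seq nat).

Lemma partsP la : [/\ sorted geq (parts la), 0%N \notin parts la & sumn (parts la) = n].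
Proof. by have /and3P[h1 h2 /eqP h3] := valP la. Qed.

Lemma parts_inj : injective (@parts n).
Proof. by move=> la mu /(inj_map val_inj) /val_inj /val_inj. Qed.

Lemma size_leq_sumn s : 0%N \notin s -> (size s <= sumn s)%N.
Proof. by elim: s => //= x s IH; rewrite inE negb_or => /andP[x0 /IH]; lia. Qed.

Lemma leq_sumn s x : x \in s -> (x <= sumn s)%N.
Proof. by move=> xs; rewrite sumnE (big_rem _ xs) leq_addr. Qed.

Lemma intpart_exists s : 0%N \notin s -> sumn s = n ->
  exists la, perm_eq s (parts la).
Proof.
move=> s0 sn; pose t := sort geq s.
have ts : perm_eq t s by rewrite /t perm_sort.
have t_n x : x \in t -> (x < n.+1)%N.
  by rewrite (perm_mem ts) ltnS -sn; apply: leq_sumn.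
have tE : map val [seq inord x : 'I_n.+1 | x <- t] = t.
  rewrite -map_comp -[RHS]map_id; apply/eq_in_map => x /t_n xn.
  by rewrite /= inordK.
have sz : (size [seq inord x : 'I_n.+1 | x <- t] <= n)%N.
  by rewrite size_map (perm_size ts) -sn size_leq_sumn.
have ip : is_intpart n (map val (Bseq sz)).
  rewrite /= tE; apply/and3P; split.
  - by apply: sort_sorted => x y; apply: leq_total.
  - by rewrite (perm_mem ts).
  - by rewrite (perm_sumn ts) sn.
by exists (IntPart ip); rewrite /parts /= tE perm_sym.
Qed.

Lemma parts_perm la mu : perm_eq (parts la) (parts mu) = (la == mu).
Proof.
apply/idP/eqP => [pe|->//]; apply: parts_inj.
have [[sl _ _] [sm _ _]] := (partsP la, partsP mu).
apply: (sorted_eq _ _ sl sm pe) => [x y z h1 h2|x y h].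
  exact: leq_trans h2 h1.
by apply/eqP; rewrite eqn_leq andbC.
Qed.

Lemma zpartE la : zpart la = zseq (parts la).
Proof.
rewrite /zpart; have [_ + sn] := partsP la.
have : all (leq^~ n) (parts la) by apply/allP => x /leq_sumn; rewrite sn.
elim: (parts la) => [|k s IH] /=; first by rewrite big1.
move=> /andP[kn sn']; rewrite inE negb_or => /andP[k0 s0].
rewrite -IH //.
have kin : k \in index_iota 1 n.+1 by rewrite mem_index_iota lt0n eq_sym k0.
rewrite !(bigD1_seq k) ?iota_uniq //= eqxx add1n.
transitivity (k ^ (count_mem k s).+1 * (count_mem k s).+1`! *
    \prod_(i <- index_iota 1 n.+1 | i != k) (i ^ count_mem i s * (count_mem i s)`!))%N.
  by congr (_ * _)%N; apply: eq_bigr => i ik; rewrite eq_sym (negPf ik).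
by rewrite expnS factS; ring.
Qed.

Lemma zpart_neq0 la : (zpart la)%:R != 0 :> rat.
Proof.
rewrite pnatr_eq0 -lt0n /zpart big_nat_cond; apply: prodn_cond_gt0 => i.
by move=> /andP[/andP[i0 _] _]; rewrite muln_gt0 expn_gt0 i0 fact_gt0.
Qed.

Lemma pairing_p_part la mu :
  pairing (parts la) (symcf (sym_p_part mu)) = (zpart la)%:R * (la == mu)%:R.
Proof.
have [_ mu0 _] := partsP mu.
by rewrite (pairing_p _ mu0) parts_perm zpartE natrM.
Qed.

Lemma p_part_homogeneous mu : homogeneous n (symcf (sym_p_part mu)).
Proof. by have [_ /p_homogeneous + sn] := partsP mu; rewrite sn. Qed.

(** The difference of both sides pairs to 0 with every sequence: by orthogonality if it rearranges
    to a partition of n, and otherwise because it contains a 0 or has the wrong sum. Then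
    [pairing_eq0] applies, so that the p_la are seen to span without a separate argument. *)
Lemma p_part_expansion (f : symfun) : homogeneous n (symcf f) ->
  f = \sum_(la : intpart n) ((zpart la)%:R^-1 * pairing (parts la) (symcf f)) *: sym_p_part la.
Proof.
move=> fn; apply/eqP; rewrite -subr_eq0; apply/eqP/symcf_inj.
set g := \sum_ _ _.
have cfB : symcf (f - g) = fun s => -1 * symcf g s + symcf f s.
  by apply/funext => s; rewrite /symcf rmorphB mulN1r addrC.
have gE : symcf g = fun s => \sum_(la : intpart n)
   ((zpart la)%:R^-1 * pairing (parts la) (symcf f)) * symcf (sym_p_part la) s.
  exact: symcf_sum.
have gn : homogeneous n (symcf g).
  by move=> s sn; rewrite gE big1 // => la _; rewrite p_part_homogeneous ?mulr0.
transitivity (fun _ : seq nat => 0 : rat); last by apply/funext => s; rewrite /symcf rmorph0.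
apply: (pairing_eq0 (symcf_zsym _)) => s; rewrite cfB pairingP.
have [s0|s0] := boolP (0%N \in s); first by rewrite !pairing0 // mulr0 addr0.
have [sn|sn] := eqVneq (sumn s) n; last first.
  by rewrite !(@pairing_homogeneous _ n) // mulr0 addr0.
have [la pe] := intpart_exists s0 sn.
rewrite !(pairing_perm _ pe); try exact: symcf_zsym.
rewrite gE pairing_sum (bigD1 la) //= big1 ?addr0 => [|mu mula].
  by rewrite pairing_p_part eqxx mulr1 mulrAC mulVf ?zpart_neq0 // mul1r mulN1r addNr.
by rewrite pairing_p_part eq_sym (negPf mula) !mulr0.
Qed.

End Partitions.

(** * The involution omega *)

Section Omega.

(** The eigenvalue of omega on p_la. The exponent [k.+1] has the parity of k - 1. *)
Definition psign (la : seq nat) : rat := \prod_(k <- la) (-1) ^+ k.+1.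

Lemma psign_sq la : psign la * psign la = 1.
Proof.
rewrite /psign -big_split big1 // => k _ /=.
by rewrite -exprD addnn -signr_odd odd_double.
Qed.

(** The adjoint of p_k sends h_d to h_(d-k), or to 0 if k > d. In the recursion all k - 1 subtracted
    terms equal the slice, so one of its k copies is left. *)
Lemma pperp_h k d s : (0 < k)%N ->
  pperp k (evs (hom_fps d)) s = (k + sumn s == d)%:R.
Proof.
elim/ltn_ind: k d s => k IH d s k0; rewrite pperpE {1}/slice evs_h /=.
rewrite (eq_big_nat _ _ (F2 := fun=> (k + sumn s == d)%:R)) => [|j /andP[j0 jk]].
  rewrite sumr_const_nat -[_ *+ (k - 1)]mulr_natl natrB //; ring.
have [kd|kd] := leqP (k - j) d; last first.
  have -> : slice (k - j) (evs (hom_fps d)) = fun=> 0.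
    by apply/funext => t; rewrite /slice evs_h /=; case: eqP => //; lia.
  by rewrite pperp_zero; case: eqP => //; lia.
have -> : slice (k - j) (evs (hom_fps d)) = evs (hom_fps (d - (k - j))).
  by apply/funext => t; rewrite /slice !evs_h /=; congr (nat_of_bool _)%:R; lia.
by rewrite IH //; congr (nat_of_bool _)%:R; lia.
Qed.

Lemma pairing_h la d : 0%N \notin la -> pairing la (symcf (sym_h d)) = (sumn la == d)%:R.
Proof.
rewrite /symcf /=; elim: la d => [|k la IH] d; first by rewrite /= evs_h.
rewrite inE negb_or => /andP[k0 la0] /=.
have [kd|kd] := leqP k d.
  have -> : pperp k (evs (hom_fps d)) = evs (hom_fps (d - k)).
    apply/funext => s; rewrite pperp_h ?lt0n 1?eq_sym // evs_h.
    by congr (nat_of_bool _)%:R; lia.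
  by rewrite IH //; congr (nat_of_bool _)%:R; lia.
have -> : pperp k (evs (hom_fps d)) = fun=> 0.
  apply/funext => s; rewrite pperp_h ?lt0n 1?eq_sym //.
  by case: eqP => //; lia.
by rewrite pairing_zero; case: eqP => //; lia.
Qed.

Lemma slice_e a d : slice a.+2 (evs (elem_fps d)) = fun=> 0.
Proof. by apply/funext => s; rewrite /slice evs_e /= andbF. Qed.

Lemma slice1_e d : slice 1 (evs (elem_fps d.+1)) = evs (elem_fps d).
Proof. by apply/funext => s; rewrite /slice !evs_e /= add1n eqSS. Qed.

Lemma slice1_e0 : slice 1 (evs (elem_fps 0)) = fun=> 0.
Proof. by apply/funext => s; rewrite /slice !evs_e. Qed.

(** Slices of e_d at exponents above 1 vanish, so only the last term of the recursion survives, and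
    each unfolding contributes a sign. *)
Lemma pperp_e k d s : pperp k.+1 (evs (elem_fps d)) s =
  if (k < d)%N then (-1) ^+ k * evs (elem_fps (d - k.+1)) s else 0.
Proof.
elim: k d s => [|k IH] d s; rewrite pperpE.
  rewrite big_geq // subr0 mul1r; case: d => [|d]; first by rewrite slice1_e0.
  by rewrite slice1_e subSS subn0 expr0 mul1r.
rewrite slice_e mulr0 sub0r big_nat_recr //= subSnn.
rewrite big_nat_cond big1 => [|j /andP[/andP[_ jk] _]]; last first.
  have -> : (k.+2 - j = (k - j).+2)%N by lia.
  by rewrite slice_e pperp_zero.
rewrite add0r; case: d => [|d]; first by rewrite slice1_e0 pperp_zero oppr0.
rewrite slice1_e IH ltnS subSS; case: ifP => _; last by rewrite oppr0.
by rewrite exprS mulN1r mulNr.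
Qed.

Lemma pairing_e la d : 0%N \notin la ->
  pairing la (symcf (sym_e d)) = psign la * (sumn la == d)%:R.
Proof.
rewrite /symcf /=; elim: la d => [|k la IH] d.
  by rewrite /= evs_e /psign big_nil mul1r /= andbT.
rewrite inE negb_or => /andP[k0 la0] /=; rewrite /psign big_cons -/(psign la).
case: k k0 => // k _.
have [kd|kd] := ltnP k d.
  have -> : pperp k.+1 (evs (elem_fps d)) =
      fun s => (-1) ^+ k * evs (elem_fps (d - k.+1)) s.
    by apply/funext => s; rewrite pperp_e kd.
  rewrite pairing_mulc IH // mulrA; congr (_ * _ * (nat_of_bool _)%:R); last lia.
  by rewrite !exprS mulrA mulrNN !mul1r.
have -> : pperp k.+1 (evs (elem_fps d)) = fun=> 0.
  by apply/funext => s; rewrite pperp_e ltnNge kd.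
by rewrite pairing_zero; case: eqP; rewrite ?mulr0 //; lia.
Qed.

Lemma sym_e_expansion k :
  sym_e k = \sum_(la : intpart k) ((zpart la)%:R^-1 * psign (parts la)) *: sym_p_part la.
Proof.
rewrite [LHS](@p_part_expansion k) => [|s sk]; last first.
  by rewrite /symcf evs_e (negPf sk).
apply: eq_bigr => la _; have [_ la0 sn] := partsP la.
by rewrite pairing_e // sn eqxx mulr1.
Qed.

Lemma sym_h_expansion k :
  sym_h k = \sum_(la : intpart k) (zpart la)%:R^-1 *: sym_p_part la.
Proof.
rewrite [LHS](@p_part_expansion k) => [|s sk]; last first.
  by rewrite /symcf evs_h (negPf sk).
apply: eq_bigr => la _; have [_ la0 sn] := partsP la.
by rewrite pairing_h // sn eqxx mulr1.
Qed.

Variable omega : {lrmorphism symfun -> symfun}.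
Hypothesis omega_e : forall k, omega (sym_e k) = sym_h k.

(** The hypothesis concerns the parts of la only, so that the lemma can be used inside the induction
    that proves [omega_p]. *)
Lemma omega_p_seq la : (forall k, k \in la -> omega (sym_p k) = (-1) ^+ k.+1 *: sym_p k) ->
  omega (sym_p_seq la) = psign la *: sym_p_seq la.
Proof.
rewrite /sym_p_seq /psign rmorph_prod; elim: la => [|k la IH] H.
  by rewrite !big_nil scale1r.
rewrite !big_cons /= H ?mem_head // IH => [|j jla]; last by rewrite H // inE jla orbT.
by rewrite -scalerAl -scalerAr scalerA.
Qed.

(* Compare omega (sym_e k) with sym_h k: by induction their power sum
   expansions agree away from the partition with the single part k. *)
Lemma omega_p k : (0 < k)%N -> omega (sym_p k) = (-1) ^+ k.+1 *: sym_p k.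
Proof.
elim/ltn_ind: k => k IH k0.
have [la0 pla] : exists la : intpart k, perm_eq [:: k] (parts la).
  by apply: intpart_exists; rewrite /= ?addn0 // inE eq_sym -lt0n.
have {}pla : parts la0 = [:: k].
  by apply: perm_small_eq; rewrite // perm_sym.
have zinv0 : (zpart la0)%:R^-1 != 0 :> rat by rewrite invr_eq0 zpart_neq0.
have ppla0 : sym_p_part la0 = sym_p k by rewrite /sym_p_part pla big_seq1.
have sgla0 : psign (parts la0) = (-1) ^+ k.+1 by rewrite pla /psign big_seq1.
have := omega_e k; rewrite sym_e_expansion sym_h_expansion linear_sum /=.
rewrite (bigD1 la0) //= [RHS](bigD1 la0) //=.
rewrite [X in _ + X](eq_bigr (fun la : intpart k => (zpart la)%:R^-1 *: sym_p_part la)).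
  move=> /addIr; rewrite linearZ /= ppla0 sgla0 => e.
  apply: (scalerI zinv0); rewrite [RHS]scalerA [_ * _]mulrC -scalerA -e !scalerA.
  congr (_ *: _); rewrite mulrC -mulrA -exprD addnn -mul2n exprM sqrrN !expr1n.
  by rewrite mulr1.
move=> la lala0; rewrite linearZ /= -/(sym_p_seq (parts la)) omega_p_seq.
  by rewrite scalerA -mulrA psign_sq mulr1.
have [_ lan0 sn] := partsP la; move=> j jla; apply: IH; last first.
  by rewrite lt0n; apply: contraNneq lan0 => <-.
rewrite ltn_neqAle; have := leq_sumn jla; rewrite sn => ->; rewrite andbT.
(* A partition of k with k among its parts has no other part: the rest sums to 0 and does not
   contain 0. *)
apply: contraNneq lala0 => jk; rewrite -parts_perm pla.
have := perm_to_rem jla; rewrite jk => pe; rewrite (perm_trans pe) // perm_cons.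
have : (sumn (rem k (parts la)) == 0)%N.
  by have := perm_sumn pe; rewrite sn /= => e; rewrite -(eqn_add2l k) addn0 -e.
have : 0%N \notin rem k (parts la) by apply: contra lan0; apply: mem_rem.
by case: (rem _ _) => //= x s; rewrite inE addn_eq0 eq_sym => /norP[/negPf ->].
Qed.

Lemma omega_expansion n (f : symfun) : homogeneous n (symcf f) ->
  omega f = \sum_(la : intpart n)
    ((zpart la)%:R^-1 * (psign (parts la) * pairing (parts la) (symcf f)))
      *: sym_p_part la.
Proof.
move=> fn; rewrite {1}(p_part_expansion fn) linear_sum; apply: eq_bigr => la _.
rewrite linearZ /= -/(sym_p_seq (parts la)) omega_p_seq ?scalerA => [|k kla].
  by rewrite -mulrA [_ * psign _]mulrC.
apply: omega_p; have [_ la0 _] := partsP la.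
by rewrite lt0n; apply: contraNneq la0 => <-.
Qed.

End Omega.

(** * Layered colorings of an acyclic digraph *)

Section Layers.

Variables (V : finType) (O : rel V).
Implicit Types (S T U W : {set V}) (s la : seq nat).

Definition sinks W := [set x in W | [forall (y | y \in W), ~~ O x y]].
Definition sources W := [set x in W | [forall (y | y \in W), ~~ O y x]].

Definition final W T :=
  (T \subset W) && [forall (x | x \in T), forall (y | y \in W), O x y ==> (y \in T)].

Lemma sinksP W x : reflect (x \in W /\ forall y, y \in W -> ~~ O x y) (x \in sinks W).
Proof. by rewrite inE; apply: (iffP andP) => -[xW /forall_inP]. Qed.

Lemma sourcesP W x : reflect (x \in W /\ forall y, y \in W -> ~~ O y x) (x \in sources W).
Proof. by rewrite inE; apply: (iffP andP) => -[xW /forall_inP]. Qed.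

Lemma finalP W T :
  reflect (T \subset W /\ forall x y, x \in T -> y \in W -> O x y -> y \in T) (final W T).
Proof.
apply: (iffP andP) => -[TW H]; split=> //.
  by move=> x y xT yW; move/forall_inP: H => /(_ x xT)/forall_inP/(_ y yW)/implyP.
by apply/forall_inP => x xT; apply/forall_inP => y yW; apply/implyP; apply: H.
Qed.

(* The number of maps W -> {0, 1, ...}, decreasing along arcs, with s`_i
   vertices of color i: the color class of 0 consists of sinks. *)
Fixpoint ncol s W : nat :=
  if s is a :: s' then
    \sum_(S : {set V} | (S \subset sinks W) && (#|S| == a)) ncol s' (W :\: S)
  else W == set0.

Definition rooted W T := final W T && (#|sources T| == 1)%N.

Fixpoint nblocks la W : nat :=
  if la is k :: la' then
    \sum_(T : {set V} | rooted W T && (#|T| == k)) nblocks la' (W :\: T)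
  else W == set0.

Hypothesis O_sink : forall U, U != set0 -> exists2 x, x \in U & forall y, y \in U -> ~~ O x y.

Definition toggle (q : V) S := if q \in S then S :\ q else q |: S.

Lemma toggleK q : involutive (toggle q).
Proof.
move=> S; rewrite {2}/toggle; case: ifP => qS; rewrite /toggle.
  by rewrite !inE eqxx setD1K.
by rewrite setU11 setU1K ?qS.
Qed.

(** If U consists of sinks of W, every vertex left after removing S is a source, so S omits exactly
    one vertex of U, with sign +1. Otherwise toggling a suitable fixed q in S keeps the sources of
    the rest and flips the sign. *)
Lemma signed_sources W U : final W U ->
  \sum_(S : {set V} | [&& S \subset sinks W, S \subset U & #|sources (U :\: S)| == 1%N])
     (-1) ^+ #|U :\: S|.+1 = (if U \subset sinks W then #|U| else 0%N)%:R :> rat.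
Proof.
move=> /finalP[UW Ufin]; case: ifP => [Usink|/negbT/subsetPn[x xU xnsink]].
  have srcE S : sources (U :\: S) = U :\: S.
    apply/setP => x; apply/sourcesP/idP => [[]//|xUS]; split=> // y.
    move: xUS; rewrite !inE => /andP[_ xU] /andP[_ yU].
    by have /sinksP[_] := subsetP Usink _ yU; apply; apply: (subsetP UW).
  rewrite (eq_bigl (fun S => S \in [set U :\ x | x in U])) => [|S].
    rewrite (eq_bigr (fun=> 1)) => [|S /imsetP[x xU ->]].
      rewrite sumr_const card_in_imset // => x y xU yU e; apply/eqP.
      have : x \notin U :\ y by rewrite -e !inE eqxx.
      by rewrite !inE xU andbT negbK.
    by rewrite setDDr setDv set0U (setIidPr _) ?sub1set // cards1 sqrrN expr1n.
  rewrite srcE; apply/and3P/imsetP => [[_ SU /cards1P[x e]]|[x xU ->]].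
    have xU : x \in U by have := set11 x; rewrite -e inE => /andP[].
    by exists x => //; rewrite -e setDDr setDv set0U; apply/esym/setIidPr.
  rewrite setDDr setDv set0U (setIidPr _) ?sub1set // cards1 subsetDl.
  by rewrite (subset_trans (subsetDl _ _) Usink).
pose U' := [set z in U | [exists (y | y \in U), O y z]].
have [y yU Oxy] : exists2 y, y \in U & O x y.
  have : ~~ [forall (y | y \in W), ~~ O x y].
    by apply: contra xnsink => H; rewrite inE H (subsetP UW).
  rewrite negb_forall_in => /exists_inP[y yW /negPn Oxy].
  by exists y => //; apply: (Ufin x).
(* Among the vertices of U with an arc from U, take q without an arc to another one. Successors of q
   in W lie in U because U is final, hence in [U']; so there are none and q is a sink of W. The
   choice does not involve S. *)
have [q] : exists2 q, q \in U' & forall z, z \in U' -> ~~ O q z.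
  by apply: O_sink; apply/set0Pn; exists y; rewrite inE yU; apply/exists_inP; exists x.
rewrite inE => /andP[qU /exists_inP[p pU Opq]] qsink'.
have qW := subsetP UW q qU.
have qout z : z \in W -> ~~ O q z.
  move=> zW; apply/negP => Oqz; have zU := Ufin q z qU zW Oqz.
  suff zU' : z \in U' by move: (qsink' z zU'); rewrite Oqz.
  by rewrite inE zU; apply/exists_inP; exists q.
have qsink : q \in sinks W by apply/sinksP.
have pnsink : p \notin sinks W by apply/sinksP => -[_ /(_ q qW)]; rewrite Opq.
(* The predecessor p of q is not a sink of W, so it is never in S and prevents q from being a
   source; as q is a sink, it prevents no other vertex from being one. *)
have src_q S : q \notin S -> S \subset sinks W ->
    sources (U :\: (q |: S)) = sources (U :\: S).
  move=> qS Ssink; apply/setP => z.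
  have pS : p \notin S by apply: contra pnsink; apply: (subsetP Ssink).
  have pq : p != q by apply: contraNneq pnsink => ->.
  apply/sourcesP/sourcesP => -[]; rewrite !inE ?negb_or.
    move=> /andP[/andP[zq zS] zU] H; rewrite zS zU; split=> // w; rewrite !inE.
    have [-> _|wq /andP[wS wU]] := eqVneq w q; first by apply/qout/(subsetP UW).
    by apply: H; rewrite !inE negb_or wq wS.
  move=> /andP[zS zU] H; have zq : z != q.
    by apply/eqP => zq; have := H p; rewrite !inE pS pU zq Opq => /(_ isT).
  rewrite zq zS zU; split=> // w; rewrite !inE negb_or => /andP[/andP[wq wS] wU].
  by apply: H; rewrite !inE wS wU.
have card_q S : q \notin S ->
    (-1) ^+ #|U :\: (q |: S)|.+1 = - (-1) ^+ #|U :\: S|.+1 :> rat.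
  move=> qS; have -> : U :\: (q |: S) = (U :\: S) :\ q.
    by apply/setP => z; rewrite !inE negb_or andbA.
  by rewrite (cardsD1 q (U :\: S)) !inE qS qU /= [in RHS]exprS mulN1r opprK.
pose Q S := [&& S \subset sinks W, S \subset U & #|sources (U :\: S)| == 1%N].
have Q_q S : q \notin S -> Q (q |: S) = Q S.
  move=> qS; rewrite /Q !subUset !sub1set qsink qU /=.
  by have [Ss|//] := boolP (S \subset sinks W); rewrite src_q.
suff : \sum_(S | Q S) (-1) ^+ #|U :\: S|.+1 = - \sum_(S | Q S) (-1) ^+ #|U :\: S|.+1 :> rat.
  by move=> h; lra.
rewrite {1}(reindex_inj (can_inj (toggleK q))) -sumrN; apply: eq_big => S.
  rewrite /toggle; case: ifP => [qS|/negbT]; last exact: Q_q.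
  by rewrite -[in RHS](setD1K qS) Q_q // !inE eqxx.
move=> _; rewrite /toggle; case: ifP => [qS|/negbT]; last exact: card_q.
by rewrite -[in RHS](setD1K qS) card_q ?opprK // !inE eqxx.
Qed.

Lemma slice_ncol a W :
  slice a (fun s => (ncol s W)%:R) =
  fun s => \sum_(S : {set V} | (S \subset sinks W) && (#|S| == a)) 1 * (ncol s (W :\: S))%:R :> rat.
Proof. by apply/funext => s; rewrite /slice /= natr_sum; under [RHS]eq_bigr do rewrite mul1r. Qed.

(* Expand both sides over the union U of the color class S with the block T
   and apply signed_sources. *)
Lemma rooted_union k W (g : {set V} -> rat) :
  \sum_(S : {set V} | S \subset sinks W)
    \sum_(T : {set V} | rooted (W :\: S) T && (#|S| + #|T| == k)%N)
       (-1) ^+ #|T|.+1 * g (S :|: T) =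
  k%:R * \sum_(S : {set V} | (S \subset sinks W) && (#|S| == k)) g S.
Proof.
transitivity (\sum_(U : {set V} | final W U && (#|U| == k))
    (if U \subset sinks W then #|U| else 0%N)%:R * g U); last first.
  rewrite mulr_sumr [LHS](bigID (fun U => U \subset sinks W)) /= [X in _ + X]big1 ?addr0.
    apply: eq_big => [U|U /andP[/andP[_ /eqP ->] ->] //].
    have [Us|] := boolP (U \subset sinks W); last by rewrite andbF.
    rewrite andbT (_ : final W U = true) //; apply/finalP; split.
      by apply: (subset_trans Us); apply/subsetP => x /sinksP[].
    by move=> x y /(subsetP Us)/sinksP[_ H] /H /negPf ->.
  by move=> U /andP[_ /negPf ->]; rewrite mul0r.
transitivity (\sum_(U : {set V} | final W U && (#|U| == k))
  \sum_(S : {set V} | [&& S \subset sinks W, S \subset U & #|sources (U :\: S)| == 1%N])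
     (-1) ^+ #|U :\: S|.+1 * g U); last first.
  by apply: eq_bigr => U /andP[Uf _]; rewrite -mulr_suml signed_sources.
rewrite [RHS](exchange_big_dep (fun S => S \subset sinks W)) /=; last by move=> U S _ /and3P[].
apply: eq_bigr => S Ss; have SW : S \subset W.
  by apply: (subset_trans Ss); apply/subsetP => x /sinksP[].
rewrite (reindex_onto (fun U => U :\: S) (fun T => S :|: T)) /=; last first.
  move=> T /andP[/andP[/finalP[TW _] _] _]; apply/setP => x; rewrite !inE.
  have := subsetP TW x; rewrite !inE; case: (x \in S) => //=.
  by case: (x \in T) => // /(_ isT).
have US U : (S :|: U :\: S == U) = (S \subset U).
  apply/eqP/idP => [<-|SU]; first exact: subsetUl.
  by apply/setP => x; have := subsetP SU x; rewrite !inE; case: (x \in S) => //= ->.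
apply: eq_big => [U|U]; rewrite US; last first.
  by move=> /andP[_ SU]; move: (US U); rewrite SU => /eqP ->.
have [SU|] := boolP (S \subset U); last by rewrite !andbF.
rewrite Ss /= andbT /rooted cardsDS // subnKC ?subset_leq_card //.
rewrite andbAC; congr (_ && _ && _).
(* The vertices of S have no arcs into W, so adding them keeps a final set final; conversely S is
   removed from both sets. *)
apply/finalP/finalP => -[USW H]; split.
- apply/subsetP => x xU; have [xS|xS] := boolP (x \in S); first exact: (subsetP SW).
  by have := subsetP USW x; rewrite !inE xS xU => /(_ isT).
- move=> x y xU yW Oxy; have [xS|xS] := boolP (x \in S).
    by have /sinksP[_ /(_ y yW)] := subsetP Ss x xS; rewrite Oxy.
  have [yS|yS] := boolP (y \in S); first exact: (subsetP SU).
  have := H x y; rewrite !inE xS yS xU yW => /(_ isT isT Oxy).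
  by [].
- by apply: setSD.
- move=> x y; rewrite !inE => /andP[xS xU] /andP[yS yW] Oxy; rewrite yS.
  exact: (H x y).
Qed.

(** In [rooted_union] the terms with S empty form the claimed sum, and by induction those with S
    nonempty form the sum subtracted in [pperpE]. *)
Lemma pperp_ncol k W s : (0 < k)%N ->
  pperp k (fun s => (ncol s W)%:R) s =
  (-1) ^+ k.+1 * \sum_(T | rooted W T && (#|T| == k)) (ncol s (W :\: T))%:R.
Proof.
elim/ltn_ind: k W s => k IH W s k0; rewrite pperpE slice_ncol.
under eq_bigr do rewrite mul1r.
rewrite -(rooted_union k W (fun U => (ncol s (W :\: U))%:R)).
rewrite (bigD1 set0) ?sub0set //= -addrA [X in _ + X](_ : _ = 0) ?addr0.
  rewrite mulr_sumr setD0 cards0; apply: eq_big => [T|T /andP[_ /eqP <-]].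
    by rewrite add0n.
  rewrite add0n.
  by rewrite set0U.
apply/eqP; rewrite subr_eq0; apply/eqP.
rewrite (eq_big_nat _ _ (F2 := fun j =>
   \sum_(S : {set V} | (S \subset sinks W) && (#|S| == k - j)%N)
   \sum_(T : {set V} | rooted (W :\: S) T && (#|T| == j))
      (-1) ^+ j.+1 * (ncol s (W :\: (S :|: T)))%:R)).
  rewrite big_nat_cond [RHS](exchange_big_dep (fun S => (S \subset sinks W) && (S != set0))) /=.
    apply: eq_bigr => S /andP[Ss S0]; rewrite [RHS]big_mkcond.
    (* If S has k or more vertices, no room is left for T, which contains its source. *)
    have [Sk|Sk] := ltnP #|S| k; last first.
      rewrite [RHS]big1 => [|j _]; last first.
        by case: ifP => // /and3P[/andP[jk _] _ /eqP]; lia.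
      apply: big1 => T /andP[/andP[_ sT] /eqP STk].
      have : (#|sources T| <= #|T|)%N by apply/subset_leq_card/subsetP => x /sourcesP[].
      by rewrite (eqP sT); lia.
    rewrite [RHS](bigD1_seq (k - #|S|)%N) ?iota_uniq //=; last first.
      by rewrite mem_index_iota; move: S0; rewrite -card_gt0; lia.
    rewrite [X in _ + X]big1 ?addr0 => [|j jS]; last first.
      by case: ifP => // /and3P[/andP[jk _] _ /eqP Skj]; case/eqP: jS; lia.
    rewrite ifT; last by move: S0; rewrite -card_gt0; lia.
    apply: eq_big => [T|T /andP[_ /eqP <-]]; first by congr (_ && _); lia.
    by rewrite addKn.
  move=> j S /andP[jk _] /andP[-> /eqP Skj]; rewrite -card_gt0 Skj; lia.
move=> j /andP[j0 jk].
rewrite slice_ncol pperp_sum; apply: eq_bigr => S _.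
by rewrite mul1r IH // mulr_sumr; apply: eq_bigr => T _; rewrite setDDl.
Qed.

Lemma nblocks_pairing la W : 0%N \notin la ->
  pairing la (fun s => (ncol s W)%:R) = psign la * (nblocks la W)%:R.
Proof.
elim: la W => [|k la IH] W; first by rewrite /= /psign big_nil mul1r.
rewrite inE negb_or eq_sym -lt0n => /andP[k0 la0].
rewrite [LHS]/= (_ : pperp k _ = fun s => (-1) ^+ k.+1 *
    \sum_(T | rooted W T && (#|T| == k)) 1 * (ncol s (W :\: T))%:R); last first.
  by apply/funext => s; rewrite pperp_ncol //; under eq_bigr do rewrite -[_%:R]mul1r.
rewrite pairing_mulc pairing_sum /psign big_cons -/(psign la) -mulrA; congr (_ * _).
rewrite /= natr_sum mulr_sumr; apply: eq_bigr => T _.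
by rewrite mul1r IH.
Qed.

End Layers.

(** * Block decompositions as words *)

Section Words.

Variables (V : finType) (O le : rel V).
Hypotheses (le_total : total le) (le_trans : transitive le) (le_anti : antisymmetric le).
Hypothesis O_le : forall x y, O x y -> ~~ le y x.
Implicit Types (S T U W : {set V}) (w u : seq V) (la : seq nat).

(** The word is a linear extension of O restricted to its letters. *)
Definition compat w := pairwise (fun x y => ~~ O y x) w.

Definition block_word u := sorted le u && (#|sources O [set x in u]| == 1%N).

(** The first part of la is the length of the last block, as in [nblocks], where final sets are
    removed first; hence the [rev la] below. *)
Fixpoint block_words la W : seq (seq V) :=
  if la is k :: la' then
    [seq w ++ sort le (enum T)
       | T <- [seq T <- enum {set V} | rooted O W T && (#|T| == k)],
         w <- block_words la' (W :\: T)]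
  else if W == set0 then [:: [::]] else [::].

Lemma size_block_words la W : size (block_words la W) = nblocks O la W.
Proof.
elim: la W => [|k la IH] W; first by rewrite /=; case: ifP.
rewrite size_allpairs_dep sumnE big_map big_filter big_enum_cond /=.
by apply: eq_bigr => T _; rewrite IH.
Qed.

(** That the last block is final means that no arc leads from it back to an earlier letter. Inside a
    block, being sorted already implies compatibility, by [O_le]. *)
Lemma mem_block_words la W w : w \in block_words la W =
  [&& uniq w, [set x in w] == W, size w == sumn la, compat w
    & all block_word (reshape (rev la) w)].
Proof.
elim: la W w => [|k la IH] W w /=.
  rewrite /reshape /= andbT; apply/idP/and4P => [|[_ /eqP <- /eqP/size0nil -> _]].
    case: eqP => // ->; rewrite inE => /eqP ->; split=> //.
  by rewrite ifT // ; apply/eqP/setP => x; rewrite !inE.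
have setE w1 T : [set x in w1 ++ sort le (enum T)] = [set x in w1] :|: T.
  by apply/setP => x; rewrite !inE mem_cat mem_sort mem_enum.
have sizeT T : size (sort le (enum T)) = #|T| by rewrite size_sort -cardE.
apply/allpairsPdep/and5P => [[T [w1 [+ + ->]]]|[uw /eqP wW /eqP sw cw]].
  rewrite mem_filter => /andP[/andP[/andP[/finalP[TW Tfin] sT] /eqP kT] _].
  rewrite IH => /and5P[uw1 /eqP w1W /eqP sw1 cw1 okw1]; split.
  - rewrite cat_uniq uw1 sort_uniq enum_uniq andbT /=; apply/hasPn => x.
    rewrite mem_sort mem_enum => xT; apply/negP => xw1.
    by have : x \in [set x in w1] by [rewrite inE]; rewrite w1W !inE xT.
  - rewrite setE w1W; apply/eqP/setP => x; rewrite !inE.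
    by have := subsetP TW x; case: (x \in T) => [-> //|_]; rewrite orbF.
  - by rewrite size_cat sizeT kT sw1 addnC.
  - rewrite /compat pairwise_cat; apply/and3P; split=> //.
      apply/allrelP => x y xw1; rewrite mem_sort mem_enum => yT; apply/negP => Oyx.
      have : x \in [set x in w1] by [rewrite inE]; rewrite w1W !inE => /andP[xT xW].
      by rewrite (Tfin y x) in xT.
    have : pairwise le (sort le (enum T)) by rewrite -sorted_pairwise //; apply: sort_sorted.
    by apply: sub_pairwise => x y; apply: contraL => /O_le.
  rewrite rev_cons reshape_rcons; last by rewrite sumn_rev size_cat sizeT kT sw1.
  rewrite sumn_rev -sw1 take_size_cat // drop_size_cat // all_rcons okw1 andbT.
  rewrite /block_word sort_sorted //= (_ : [set x in _] = T) //.
  by apply/setP => x; rewrite inE mem_sort mem_enum.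
rewrite rev_cons reshape_rcons ?sumn_rev ?sw 1?addnC // all_rcons => /andP[/andP[su ou] okw].
pose u := drop (sumn la) w; pose w1 := take (sumn la) w.
have wE : w = w1 ++ u by rewrite cat_take_drop.
exists [set x in u], w1; rewrite mem_filter mem_enum andbT.
have uE : sort le (enum [set x in u]) = u.
  apply: (sorted_eq le_trans le_anti) => //; first exact: sort_sorted.
  rewrite perm_sort; apply: uniq_perm; rewrite ?enum_uniq //.
    by move: uw; rewrite wE cat_uniq => /and3P[].
  by move=> x; rewrite mem_enum inE.
move: uw cw; rewrite wE cat_uniq /compat pairwise_cat => /and3P[uw1 /hasPn disj uu].
move=> /and3P[/allrelP cwu cw1 cu].
have su' : size u = k by rewrite size_drop sw addnK.
split; last by rewrite uE.
  apply/andP; split; last first.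
    by rewrite -su' cardsE; apply/eqP/card_uniqP.
  apply/andP; split=> //; apply/finalP; split.
    by rewrite -wW wE; apply/subsetP => x; rewrite !inE mem_cat => ->; rewrite orbT.
  move=> x y; rewrite !inE => xu; rewrite -wW wE inE mem_cat => /orP[yw1|//] Oxy.
  by have := cwu y x yw1 xu; rewrite Oxy.
rewrite IH uw1 /compat cw1 okw /= size_takel ?sw ?leq_addl // eqxx !andbT.
apply/eqP/setP => x; rewrite -wW wE !inE mem_cat.
by case: (boolP (x \in u)) => [/disj /negPf|]; rewrite ?orbF.
Qed.

Lemma uniq_block_words la W : uniq (block_words la W).
Proof.
elim: la W => [|k la IH] W /=; first by case: ifP.
apply: allpairs_uniq_dep => [|T _|]; [by rewrite filter_uniq ?enum_uniq|exact: IH|].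
move=> [T1 w1] [T2 w2] /allpairsPdep[T1' [w1' [_ h1 e1]]] /allpairsPdep[T2' [w2' [_ h2 e2]]].
rewrite e1 e2 /= => {e1 e2 T1 w1 T2 w2} /eqP.
move: h1 h2; rewrite !mem_block_words => /and5P[_ _ /eqP s1 _ _] /and5P[_ _ /eqP s2 _ _].
rewrite eqseq_cat ?s1 ?s2 // => /andP[/eqP -> /eqP e].
suff -> : T1' = T2' by [].
by apply/setP => x; rewrite -mem_enum -(mem_sort le) e mem_sort mem_enum.
Qed.

End Words.

(** * Orientations induced by permutations *)

Section PermutationWords.

Variables (n : nat) (E : rel 'I_n).
Hypothesis E_irr : irreflexive E.
Implicit Types (s : 'S_n) (x y : 'I_n) (w u : seq 'I_n).

Notation adj := (adj E).

Lemma adj_sym x y : adj x y = adj y x. Proof. exact: orbC. Qed.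
Lemma adj_irr x : adj x x = false. Proof. by rewrite /Defs.adj E_irr. Qed.

Definition before s : rel 'I_n := fun x y => ((s^-1)%g x < (s^-1)%g y)%N.

(** Acyclic orientations of G are represented as those induced by permutations, so that the
    positions in s witness acyclicity. *)
Definition arcs s : {set 'I_n * 'I_n} := [set e | adj e.1 e.2 && before s e.1 e.2].

Definition arc (O : {set 'I_n * 'I_n}) : rel 'I_n := fun x y => (x, y) \in O.

Lemma arcE s x y : arc (arcs s) x y = adj x y && before s x y.
Proof. by rewrite /arc inE. Qed.

Lemma before_trans s : transitive (before s).
Proof. by move=> y x z; apply: ltn_trans. Qed.

Lemma before_irr s : irreflexive (before s).
Proof. by move=> x; apply: ltnn. Qed.

Lemma before_total s x y : x != y -> before s x y || before s y x.
Proof. by move=> xy; rewrite /before -neq_ltn val_eqE (inj_eq perm_inj). Qed.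

Lemma size_perm_word s : size (perm_word s) = n.
Proof. by rewrite size_map size_enum_ord. Qed.

Lemma mem_perm_word s x : x \in perm_word s.
Proof. by apply/mapP; exists ((s^-1)%g x); rewrite ?mem_enum ?permKV. Qed.

Lemma uniq_perm_word s : uniq (perm_word s).
Proof. by rewrite map_inj_uniq ?enum_uniq //; apply: perm_inj. Qed.

Lemma perm_word_before s : sorted (before s) (perm_word s).
Proof.
rewrite sorted_map (eq_sorted (e' := relpre val ltn)) => [|i j].
  by rewrite -sorted_map val_enum_ord iota_ltn_sorted.
by rewrite /= /before !permK.
Qed.

Lemma nth_perm_word x0 s (i : 'I_n) : nth x0 (perm_word s) i = s i.
Proof. by rewrite /perm_word (nth_map x0) ?size_enum_ord // nth_ord_enum. Qed.

Lemma perm_word_inj : injective (@perm_word n).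
Proof.
move=> s t e; apply/permP => i.
by rewrite -!(nth_perm_word i) e.
Qed.

Lemma perm_word_surj w : uniq w -> size w = n -> exists s, w = perm_word s.
Proof.
case: (posnP n) => [n0|n0] uw sw.
  exists 1%g; rewrite (size0nil (etrans sw n0)).
  by apply/esym/size0nil; rewrite size_perm_word.
pose x0 := Ordinal n0.
have fI : injective (fun i : 'I_n => nth x0 w i).
  move=> i j /eqP; rewrite nth_uniq ?sw // => /eqP; exact: val_inj.
exists (perm fI); apply: (@eq_from_nth _ x0); rewrite ?size_perm_word // sw => i ltin.
by rewrite (nth_perm_word x0 _ (Ordinal ltin)) permE.
Qed.

Lemma subseq_perm_word s w : subseq w (perm_word s) = sorted (before s) w.
Proof.
apply/idP/idP => [sub|sw]; first exact: (subseq_sorted (@before_trans s) sub (perm_word_before s)).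
have -> : w = [seq x <- perm_word s | x \in w].
  apply: (irr_sorted_eq (@before_trans s) (@before_irr s)) => //.
    exact: (sorted_filter (@before_trans s) _ (perm_word_before s)).
  by move=> x; rewrite mem_filter mem_perm_word andbT.
exact: filter_subseq.
Qed.

Lemma sorted_arc s w : sorted (arc (arcs s)) w = subseq w (perm_word s) && sorted adj w.
Proof.
rewrite subseq_perm_word andbC -sorted_relI; apply: eq_sorted => x y.
exact: arcE.
Qed.

(** The subwords in the definition of the rank are the directed paths of the orientation. *)
Lemma Grank_arcs s t x : arcs s = arcs t -> Grank E s x = Grank E t x.
Proof.
move=> st; apply: eq_bigl => w; rewrite andbA -sorted_arc st sorted_arc.
by rewrite -andbA.
Qed.

(** A longest path ending in x is extended by y. This provides the hypothesis [O_le] for the order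
    by (rank, label). *)
Lemma Grank_arc s x y : arc (arcs s) x y -> (Grank E s x < Grank E s y)%N.
Proof.
move=> Oxy; rewrite /Grank.
have [w /and4P[w1 w2 w3 w4] ->] : {w : n.-bseq 'I_n |
   [&& subseq w (perm_word s), sorted adj w, (w : seq 'I_n) != [::] & last x w == x]
   & \max_(w : n.-bseq 'I_n |
    [&& subseq w (perm_word s), sorted adj w, (w : seq 'I_n) != [::] & last x w == x])
  size w = size w}.
  apply: eq_bigmax_cond; apply/card_gt0P.
  have sz : (size [:: x] <= n)%N by apply: leq_trans (ltn_ord x).
  by exists (Bseq sz); rewrite unfold_in /= sub1seq mem_perm_word eqxx.
have srt : sorted (arc (arcs s)) (rcons w y).
  case: (bseqval w) w1 w2 w3 w4 => // a u w1 w2 _ /= /eqP lu.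
  have : sorted (arc (arcs s)) (a :: u) by rewrite sorted_arc w1.
  by rewrite /= rcons_path lu => ->.
have sz : (size (rcons w y) <= n)%N.
  move: srt; rewrite sorted_arc => /andP[/size_subseq + _].
  by rewrite size_perm_word.
move: srt; rewrite sorted_arc => /andP[h1 h2].
apply: leq_trans (leq_bigmax_cond (Bseq sz) _); first by rewrite /= size_rcons.
by rewrite /= h1 h2 last_rcons eqxx andbT -size_eq0 size_rcons.
Qed.

End PermutationWords.

(** * Permutations with prescribed arcs *)

Lemma pairwise_index (T : eqType) (r : rel T) (u : seq T) x y :
  pairwise r u -> x \in u -> y \in u -> (index x u < index y u)%N -> r x y.
Proof.
move=> /(pairwiseP x) pw xu yu xy.
have := pw (index x u) (index y u); rewrite !nth_index // !inE !index_mem.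
exact.
Qed.

Lemma subseq_reshape (T : eqType) (sh : seq nat) (w u : seq T) :
  u \in reshape sh w -> subseq u w.
Proof.
elim: sh w => [|k sh IH] w //=; rewrite inE => /orP[/eqP ->|/IH h].
  exact: take_subseq.
exact: subseq_trans h (drop_subseq _ _).
Qed.

Section ArcClasses.

Variables (n : nat) (E : rel 'I_n).
Hypothesis E_irr : irreflexive E.
Implicit Types (s : 'S_n) (x y : 'I_n) (w u : seq 'I_n).

Notation adj := (adj E).
Notation arcs := (arcs E).

Lemma pairwise_perm_word (r : rel 'I_n) s x y :
  pairwise r (perm_word s) -> before s x y -> r x y.
Proof.
move=> /(pairwiseP x) pw xy.
have := pw ((s^-1)%g x) ((s^-1)%g y); rewrite !nth_perm_word !permKV.
by apply; rewrite ?inE ?size_perm_word.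
Qed.

Lemma adj_arc s x y : adj x y = arc (arcs s) x y || arc (arcs s) y x.
Proof.
rewrite !arcE (adj_sym E y x) -andb_orr.
have [->|xy] := eqVneq x y; first by rewrite adj_irr.
by rewrite before_total ?andbT.
Qed.

(** Both are orientations of the same graph, so they coincide as soon as no arc of one is reversed
    in the other. *)
Lemma compat_perm_word s s0 : compat (arc (arcs s0)) (perm_word s) = (arcs s == arcs s0).
Proof.
apply/idP/eqP => [cs|<-]; last first.
  have : pairwise (before s) (perm_word s).
    by rewrite -sorted_pairwise; [exact: perm_word_before|exact: before_trans].
  apply: sub_pairwise => x y xy; rewrite arcE negb_and orbC.
  by rewrite /before -leqNgt ltnW.
apply/setP => -[x y]; rewrite -/(arc _ x y) -/(arc (arcs s0) x y) arcE.
apply/idP/idP => [/andP[xy bxy]|Oxy].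
  move: xy; rewrite (adj_arc s0) => /orP[//|Oyx].
  by have := pairwise_perm_word cs bxy; rewrite /= Oyx.
have xy : adj x y by rewrite (adj_arc s0) Oxy.
rewrite xy /=; have /(before_total s)/orP[//|byx] : x != y.
  by apply/eqP => exy; rewrite exy adj_irr in xy.
by have := pairwise_perm_word cs byx; rewrite /= Oxy.
Qed.

(* In a compatible word the letters without an earlier neighbor are exactly the
   sources. *)
Lemma Gisolated_sources s u : u != [::] -> uniq u -> compat (arc (arcs s)) u ->
  ~~ has (Gisolated E u) u = (#|sources (arc (arcs s)) [set x in u]| == 1%N).
Proof.
case: u => // a u' _; set u := a :: u'; set O := arc _ => uu cu.
have au : a \in u by rewrite mem_head.
have isoP x : x \in u -> x != a -> Gisolated E u x = (x \in sources O [set x in u]).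
  move=> xu xa; have i0 : (0 < index x u)%N by rewrite /= eq_sym (negPf xa).
  rewrite /Gisolated xu i0 /=; apply/allP/sourcesP => [H|[_ H] y ytk].
    split=> [|y]; rewrite inE // => yu; apply/negP => Oyx.
    have yx : adj y x by rewrite (adj_arc s) -/O Oyx.
    case: (ltngtP (index y u) (index x u)) => ixy.
    - by have := H y; rewrite in_take // ixy yx => /(_ isT).
    - by have := pairwise_index cu xu yu ixy; rewrite /= Oyx.
    - by move: yx; rewrite -(nth_index a xu) -ixy nth_index // adj_irr.
  have yu := mem_take ytk; rewrite in_take // in ytk.
  rewrite (adj_arc s) -/O negb_or H ?inE //.
  exact: (pairwise_index cu yu xu ytk).
have asrc : a \in sources O [set x in u].
  apply/sourcesP; split=> [|y]; rewrite inE // inE => /orP[/eqP ->|yu'].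
    by apply/negP => Oaa; have := adj_arc s a a; rewrite -/O Oaa adj_irr.
  by move: cu => /= /andP[/allP/(_ y yu')].
apply/hasPn/eqP => [noiso|/eqP/cards1P[b sb] x xu].
  rewrite (_ : sources _ _ = [set a]) ?cards1 //; apply/eqP; rewrite eq_sym.
  rewrite eqEsubset sub1set asrc /=; apply/subsetP => x xs; rewrite inE.
  have xu : x \in u by move: xs => /sourcesP[]; rewrite inE.
  by apply: contraT => xa; have := noiso x xu; rewrite isoP // xs.
apply/negP => ix; have xa : x != a.
  by apply: contraTneq ix => ->; rewrite /Gisolated /= eqxx andbF.
by move: ix asrc; rewrite isoP // sb !inE => /eqP xb /eqP ab; rewrite xb ab eqxx in xa.
Qed.

(** All permutations with the arcs of s0 have its ranks, hence the same order [le] on letters. For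
    the words of [block_words], a unique source in a block says that no letter is isolated, and
    sortedness that there is no G-descent. *)
Lemma card_Nset_arcs (la : intpart n) s0 :
  nblocks (arc (arcs s0)) (rev (parts la)) setT =
  #|[set s in Nset E la | arcs s == arcs s0]|.
Proof.
pose le x y := ~~ Gdescent E s0 x y.
have leE x y : le x y = (Grank E s0 x <= Grank E s0 y)%N &&
    ((Grank E s0 x == Grank E s0 y) ==> (x <= y)%N).
  by rewrite /le /Gdescent negb_or negb_and -leqNgt -leqNgt implybE.
have le_total : total le by move=> x y; rewrite !leE; lia.
have le_trans : transitive le by move=> y x z; rewrite !leE; lia.
have le_anti : antisymmetric le.
  by move=> x y h; apply: val_inj; move: h; rewrite /= !leE; lia.
have O_le x y : arc (arcs s0) x y -> ~~ le y x.
  by move=> /Grank_arc; rewrite leE; lia.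
rewrite -(size_block_words _ le) cardE -(size_map (@perm_word n)).
have [_ la0 sn] := partsP la.
have mem_pw s : (perm_word s \in block_words (arc (arcs s0)) le (rev (parts la)) setT)
    = (s \in [set s in Nset E la | arcs s == arcs s0]).
  rewrite mem_block_words // revK uniq_perm_word size_perm_word sumn_rev sn eqxx.
  rewrite compat_perm_word !inE (_ : [set x in _] = setT); last first.
    by apply/setP => x; rewrite !inE mem_perm_word.
  rewrite eqxx /= [RHS]andbC; have [sE|//] := eqVneq (arcs s) (arcs s0).
  apply: eq_in_all => u us; have su := subseq_reshape us.
  rewrite /block_word andbC -Gisolated_sources; first 1 last.
  (* An empty block would make 0 one of the parts. *)
  - apply: contraNneq la0 => u0; rewrite -(reshapeKl (s := perm_word s) (sh := parts la)).
      by apply/mapP; exists u => //; rewrite u0.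
    by rewrite sn size_perm_word.
  - exact: subseq_uniq su (uniq_perm_word s).
  - by apply: subseq_pairwise su _; rewrite -/(compat _ _) compat_perm_word sE.
  congr (_ && _); apply: eq_sorted => x y; rewrite /le /Gdescent.
  by rewrite !(Grank_arcs _ sE).
apply/perm_size/uniq_perm.
- exact: uniq_block_words.
- by rewrite map_inj_uniq ?enum_uniq //; apply: perm_word_inj.
move=> w; apply/idP/mapP => [wb|[s]]; last by rewrite mem_enum -mem_pw => ? ->.
move: (wb); rewrite mem_block_words // => /and5P[uw _ /eqP sw _ _].
have [|s ws] := perm_word_surj uw; first by rewrite sw sumn_rev.
by exists s; rewrite // mem_enum -mem_pw -ws.
Qed.

End ArcClasses.

(** * Colorings *)

Section CountColorings.

Variables (V : finType) (O : rel V) (M : nat).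
Implicit Types (W S : {set V}) (d : {ffun V -> 'I_M.+1}) (s : seq nat).

(* Prescribing the colors outside W lets the color classes be removed from W one
   by one without changing the type of the colorings. *)
Definition extends_coloring d0 i s W d : Prop :=
  [/\ forall x, x \notin W -> d x = d0 x,
      forall x, x \in W -> (i <= d x)%N,
      forall x y, x \in W -> y \in W -> O x y -> (d y < d x)%N
    & forall j, #|[set x in W | d x == (i + j)%N :> nat]| = nth 0%N s j].

(** Colors decrease along arcs and are at least i on W, so the class of color i consists of sinks of
    W. Conversely any a sinks can form it, and the rest is counted by induction. *)
Lemma card_extends_coloring d0 i s W : (i + size s <= M)%N ->
  #|[set d | `[< extends_coloring d0 i s W d >]]| = ncol O s W.
Proof.
elim: s d0 i W => [|a s IH] d0 i W /= iM.
  have [->|/set0Pn[x xW]] := eqVneq W set0.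
    rewrite (_ : [set d | _] = [set d0]) ?cards1 //; apply/setP => d; rewrite !inE.
    apply/asboolP/eqP => [[H _ _ _]|->]; first by apply/ffunP => x; rewrite H ?inE.
    by split=> [//|x|x y|j]; rewrite ?inE // nth_nil; apply: eq_card0 => x; rewrite !inE.
  apply: eq_card0 => d; rewrite inE; apply/asboolP => -[_ H _ C].
  have := C (d x - i)%N; rewrite nth_nil subnKC ?H // => /eqP.
  by rewrite cards_eq0 => /eqP/setP/(_ x); rewrite !inE xW eqxx.
pose cls d : {set V} := [set x in W | d x == i :> nat].
rewrite -sum1_card (partition_big cls xpredT) //= [RHS]big_mkcond.
apply: eq_bigr => S _; have iM' : (i < M.+1)%N by lia.
(* The removed class S now counts as outside and is prescribed the color i. *)
pose d1 : {ffun V -> 'I_M.+1} := [ffun x => if x \in S then Ordinal iM' else d0 x].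
have step d : (d \in [set d | `[< extends_coloring d0 i (a :: s) W d >]]) && (cls d == S) =
    [&& S \subset sinks O W, #|S| == a
      & d \in [set d | `[< extends_coloring d1 i.+1 s (W :\: S) d >]]].
  rewrite !inE; apply/andP/and3P => [[/asboolP[H1 H2 H3 H4] /eqP clsS]|].
    have inS x : (x \in S) = (x \in W) && (d x == i :> nat) by rewrite -clsS inE.
    split.
    - apply/subsetP => x; rewrite inS => /andP[xW /eqP dx]; apply/sinksP; split=> // y yW.
      by apply/negP => /(H3 x y xW yW); rewrite dx ltnNge H2.
    - by rewrite -clsS; have := H4 0%N; rewrite addn0 => ->.
    apply/asboolP; split.
    - move=> x; rewrite inE negb_and negbK ffunE => xWS.
      case: ifP => [|xS]; first by rewrite inS => /andP[_ /eqP dx]; apply: val_inj.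
      by rewrite xS in xWS; rewrite H1.
    - move=> x; rewrite inE inS negb_and => /andP[+ xW]; rewrite xW /= => di.
      by rewrite ltn_neqAle eq_sym di H2.
    - by move=> x y; rewrite !inE => /andP[_ xW] /andP[_ yW]; apply: H3.
    move=> j; have /= <- := H4 j.+1; apply: eq_card => x; rewrite !inE inS addnS addSn.
    by case: (x \in W) => //=; case: eqP => [->|]; rewrite ?andbF ?andbT //; lia.
  move=> [Ssink /eqP Sa /asboolP[H1 H2 H3 H4]].
  have SW x : x \in S -> x \in W by move=> /(subsetP Ssink)/sinksP[].
  have dS x : x \in S -> d x = i :> nat.
    by move=> xS; rewrite H1 ?inE ?xS // ffunE xS.
  have dW x : x \in W -> x \notin S -> (i < d x)%N.
    by move=> xW xS; apply: H2; rewrite inE xS.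
  have clsS : cls d = S.
    apply/setP => x; rewrite inE; have [xS|xS] := boolP (x \in S).
      by rewrite SW // dS // eqxx.
    by apply/negP => /andP[xW /eqP dx]; have := dW x xW xS; rewrite dx ltnn.
  rewrite clsS eqxx; split=> //; apply/asboolP; split.
  - move=> x xW; have xS : x \notin S by apply: contra xW; apply: SW.
    by rewrite H1 ?inE ?(negPf xW) ?andbF // ffunE (negPf xS).
  - move=> x xW; have [/dS -> //|xS] := boolP (x \in S).
    by rewrite ltnW ?dW.
  - move=> x y xW yW Oxy; have [xS|xS] := boolP (x \in S).
      by have /sinksP[_ /(_ y yW)] := subsetP Ssink x xS; rewrite Oxy.
    have [yS|yS] := boolP (y \in S); first by rewrite (dS y) ?dW.
    by apply: H3; rewrite ?inE ?xS ?yS.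
  case=> [|j]; first by rewrite addn0 -/(cls d) clsS.
  rewrite /= -H4; apply: eq_card => x; rewrite !inE addnS addSn.
  have [/dS ->|_] := boolP (x \in S); last by [].
  by rewrite /= andbC; case: eqP => //; lia.
rewrite (eq_bigl _ _ step); case: ifP => [/andP[-> ->]|ca] /=.
  by rewrite sum1_card IH //; lia.
by rewrite big_pred0 // => d; rewrite andbA ca.
Qed.

End CountColorings.

(** * The chromatic quasisymmetric function *)

Section Chromatic.

Variables (n : nat) (E : rel 'I_n).
Hypothesis E_irr : irreflexive E.
Implicit Types (c : 'I_n -> nat) (O : {set 'I_n * 'I_n}) (s : seq nat).

Notation adj := (adj E).
Notation arcs := (arcs E).

Definition coloring_arcs c : {set 'I_n * 'I_n} :=
  [set e | adj e.1 e.2 && (c e.2 < c e.1)%N].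

(** The common value of [asc] for the colorings and [Ginv] for the permutations inducing O; it
    carries the exponent of t from one side to the other. *)
Definition reversed O := #|[set e in edges E | (e.2, e.1) \in O]|.

Lemma reversed_arcs (t : 'S_n) : reversed (arcs t) = Ginv E t.
Proof.
apply: eq_card => e; rewrite !inE /=.
by case: (boolP (E _ _)) => //= ee; rewrite /Defs.adj ee orbT.
Qed.

Lemma reversed_coloring c : reversed (coloring_arcs c) = asc E c.
Proof.
apply: eq_card => e; rewrite !inE /=.
by case: (boolP (E _ _)) => //= ee; rewrite /Defs.adj ee orbT.
Qed.

Lemma proper_coloringP c :
  reflect (forall u v, adj u v -> c u != c v) (proper_coloring E c).
Proof.
apply: (iffP forallP) => [H u v uv|H u]; first by have /forallP/(_ v)/implyP := H u; apply.
by apply/forallP => v; apply/implyP; apply: H.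
Qed.

(** List the vertices by weakly decreasing color; ties do not matter, as adjacent vertices have
    different colors. *)
Lemma coloring_arcs_mem c : proper_coloring E c -> coloring_arcs c \in [set arcs t | t : 'S_n].
Proof.
move=> /proper_coloringP pc; pose ge x y := (c y <= c x)%N.
have ge_trans : transitive ge by move=> y x z h1 h2; apply: leq_trans h2 h1.
have us : uniq (sort ge (enum 'I_n)) by rewrite sort_uniq enum_uniq.
have [|t tE] := perm_word_surj us; first by rewrite size_sort size_enum_ord.
have pw : pairwise ge (perm_word t).
  rewrite -tE -sorted_pairwise //; apply: sort_sorted => x y; exact: leq_total.
apply/imsetP; exists t => //; apply/setP => -[x y]; rewrite !inE /=.
have [xy|//] := boolP (adj x y); apply/idP/idP => /= cxy.
  have /(before_total t)/orP[//|/(pairwise_perm_word pw)] : x != y.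
    by apply: contraTneq xy => ->; rewrite adj_irr.
  by rewrite /ge leqNgt cxy.
by rewrite ltn_neqAle eq_sym pc //; apply: pairwise_perm_word pw cxy.
Qed.

Lemma coloring_arcsP c (t : 'S_n) :
  proper_coloring E c && (coloring_arcs c == arcs t) <->
  (forall x y, arc (arcs t) x y -> (c y < c x)%N).
Proof.
split=> [/andP[_ /eqP <-] x y|H]; first by rewrite /arc inE /= => /andP[].
apply/andP; split.
  apply/proper_coloringP => x y; rewrite (adj_arc E_irr t) neq_ltn => /orP[] /H -> //.
  by rewrite orbT.
apply/eqP/setP => -[x y]; rewrite inE /= -/(arc (arcs t) x y) (adj_arc E_irr t).
apply/andP/idP => [[/orP[//|/H] cyx] cxy|Oxy]; last by rewrite Oxy H.
by rewrite ltnNge ltnW in cxy.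
Qed.

Lemma coloring_monomialE c m : coloring_monomial c = m <->
  (forall j, #|[set x | c x == j]| = m j).
Proof.
have E1 j : coloring_monomial c j = #|[set x | c x == j]|.
  rewrite /coloring_monomial (big_morph (fun m : {cmonom nat} => m j) (cmM j) (cm1 j)).
  rewrite -sum1_card [RHS]big_mkcond /=; apply: eq_bigr => x _.
  by rewrite cmU inE; case: eqP.
split=> [<- j|H]; first by rewrite E1.
by apply/eqP/cmP => j; rewrite E1.
Qed.

Lemma chromatic_coef_ncol k s :
  chromatic_qsym_coef E k (mon s) =
  \sum_(O in [set arcs t | t : 'S_n] | reversed O == k) (ncol (arc O) s setT)%:R.
Proof.
(* A color type that suits [card_extends_coloring] with M = size s. The extra color size s is never
   taken, since [nth] returns 0 there. *)
pose C := {ffun 'I_n -> 'I_(size s).+1}.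
pose f (c : {ffun 'I_n -> finsupp (mon s)}) : C := [ffun x => inord (val (c x))].
have fE (c : {ffun 'I_n -> finsupp (mon s)}) x : f c x = val (c x) :> nat.
  rewrite ffunE inordK // ltnW // ltnS; have := valP (c x); rewrite mem_finsupp_mon.
  by apply: contraR; rewrite -leqNgt => h; rewrite nth_default.
have f_inj : injective f.
  by move=> c d cd; apply/ffunP => x; apply: val_inj; rewrite -!fE cd.
pose B (d : C) := [&& proper_coloring E (fun x => d x), asc E (fun x => d x) == k
  & `[< forall j, #|[set x | d x == j :> nat]| = nth 0%N s j >]].
have BE (c : {ffun 'I_n -> finsupp (mon s)}) : B (f c) = (let c' := fun v => val (c v) in
      [&& proper_coloring E c', asc E c' == k & coloring_monomial c' == mon s]).
  rewrite /B /= (_ : (fun x => _) = (fun v => val (c v))); last first.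
    by apply/funext => x; rewrite fE.
  congr [&& _, _ & _]; apply/asboolP/eqP => [H|/coloring_monomialE H j].
    by apply/coloring_monomialE => j; rewrite monE -H; apply: eq_card => x; rewrite !inE fE.
  by rewrite -monE -H; apply: eq_card => x; rewrite !inE fE.
rewrite -natr_sum; congr (_%:R).
transitivity #|[set d | B d]|.
  rewrite -(card_imset _ f_inj); apply: eq_card => d; rewrite [in RHS]inE.
  apply/imsetP/idP => [[c cB ->]|dB]; first by rewrite inE -BE in cB.
  have dm x : val (d x) \in finsupp (mon s).
    have /and3P[_ _ /asboolP H] := dB; rewrite mem_finsupp_mon -H.
    by rewrite -lt0n card_gt0; apply/set0Pn; exists x; rewrite inE.
  pose c : {ffun 'I_n -> finsupp (mon s)} := [ffun x => FSetSub (dm x)].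
  have fc : f c = d by apply/ffunP => x; apply: val_inj; rewrite /= fE ffunE.
  by exists c; rewrite ?fc // inE -BE fc.
rewrite -sum1_card (partition_big (fun d : C => coloring_arcs (fun x => d x))
  (fun O => (O \in [set arcs t | t : 'S_n]) && (reversed O == k))) /=; last first.
  move=> d; rewrite inE => /and3P[pd /eqP <- _].
  by rewrite coloring_arcs_mem // reversed_coloring eqxx.
apply: eq_bigr => O /andP[/imsetP[t _ ->] /eqP rk].
rewrite -(@card_extends_coloring _ (arc (arcs t)) (size s) [ffun=> ord0] 0) ?add0n //.
rewrite -[RHS]sum1_card; apply: eq_bigl => d; rewrite !inE /B.
apply/andP/asboolP => [[/and3P[pd _ /asboolP Hc] ct]|[_ _ H Hc]].
  have H : forall x y, arc (arcs t) x y -> (d y < d x)%N.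
    by apply/coloring_arcsP; rewrite pd.
  split=> [x|//|x y _ _|j]; [by rewrite inE|exact: H|].
  by rewrite -Hc; apply: eq_card => x; rewrite !inE.
have /andP[pd ct] : proper_coloring E (fun x => d x) && (coloring_arcs (fun x => d x) == arcs t).
  by apply/coloring_arcsP => x y; apply: H; rewrite inE.
rewrite pd ct -reversed_coloring (eqP ct) rk eqxx; split=> //; apply/asboolP => j.
by rewrite -Hc; apply: eq_card => x; rewrite !inE.
Qed.

Lemma arc_sink (t : 'S_n) (U : {set 'I_n}) : U != set0 ->
  exists2 x, x \in U & forall y, y \in U -> ~~ arc (arcs t) x y.
Proof.
case/set0Pn => x0 x0U; case: (arg_maxnP (fun x => (t^-1)%g x : nat) x0U) => x xU xmax.
exists x => // y yU; rewrite arcE negb_and orbC -leqNgt.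
by apply/orP; left; apply: xmax.
Qed.

Lemma pairing_chromatic k (la : intpart n) : zsym (evs (chromatic_qsym_coef E k)) ->
  pairing (parts la) (evs (chromatic_qsym_coef E k)) =
  psign (parts la) * #|[set t in Nset E la | Ginv E t == k]|%:R.
Proof.
move=> Xs; have [_ la0 _] := partsP la.
(* The parts are reversed before the sum is split, as the summands of single orientations need not
   be symmetric. *)
rewrite (pairing_perm (mu := rev (parts la))) //; last by rewrite perm_sym perm_rev.
have -> : evs (chromatic_qsym_coef E k) = fun s =>
    \sum_(O in [set arcs t | t : 'S_n] | reversed O == k) 1 * (ncol (arc O) s setT)%:R.
  by apply/funext => s; rewrite /evs chromatic_coef_ncol; under [RHS]eq_bigr do rewrite mul1r.
rewrite pairing_sum.
have -> : psign (parts la) = psign (rev (parts la)).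
  by apply: perm_big; rewrite perm_sym perm_rev.
rewrite -sum1_card (partition_big arcs
  (fun O => (O \in [set arcs t | t : 'S_n]) && (reversed O == k))) /=; last first.
  by move=> t; rewrite inE -reversed_arcs => /andP[_ ->]; rewrite andbT; apply: imset_f.
rewrite natr_sum mulr_sumr; apply: eq_bigr => O /andP[/imsetP[t _ ->] /eqP rk].
rewrite mul1r nblocks_pairing ?mem_rev //; last exact: arc_sink.
rewrite card_Nset_arcs // -sum1_card; congr (_ * _%:R); apply: eq_bigl => u.
rewrite !inE -andbA; congr (_ && _).
by have [ut|] := eqVneq (arcs u) (arcs t); rewrite ?andbF // -reversed_arcs ut rk eqxx.
Qed.

Lemma chromatic_homogeneous k : homogeneous n (evs (chromatic_qsym_coef E k)).
Proof.
move=> s sn; rewrite /evs /chromatic_qsym_coef (_ : #|_| = 0%N) //.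
apply: eq_card0 => c; rewrite !inE; apply/negP => /and3P[_ _ /eqP/(congr1 mdeg)].
rewrite mdeg_mon /coloring_monomial mdeg_prod => e; case/eqP: sn; rewrite -e.
by under eq_bigr do rewrite mdegU; rewrite sum1_card card_ord.
Qed.

Lemma coef_chromatic k : (chromatic_qsym E)`_k = chromatic_qsym_coef E k.
Proof.
rewrite coef_poly; case: ltnP => // kE; apply/funext => m.
rewrite /chromatic_qsym_coef (_ : #|_| = 0%N) //.
apply: eq_card0 => c; rewrite !inE; apply/negP => /and3P[_ /eqP ak _].
suff : (k <= #|edges E|)%N by rewrite leqNgt kE.
by rewrite -ak; apply: subset_leq_card; apply/subsetP => e; rewrite inE => /andP[].
Qed.

End Chromatic.

(** * Positivity *)

Lemma pairing_p_sum n (c : intpart n -> rat) (la : intpart n) :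
  pairing (parts la) (symcf (\sum_(mu : intpart n) c mu *: sym_p_part mu)) =
  (zpart la)%:R * c la.
Proof.
rewrite symcf_sum pairing_sum (bigD1 la) //= pairing_p_part eqxx mulr1 mulrC.
rewrite big1 ?addr0 // => mu mula.
by rewrite pairing_p_part eq_sym (negPf mula) !mulr0.
Qed.

Lemma coef_p_sum n (c : intpart n -> {poly rat}) k :
  (\sum_(la : intpart n) map_poly (fun a : rat => a *: sym_p_part la) (c la))`_k =
  \sum_(la : intpart n) (c la)`_k *: sym_p_part la.
Proof. by rewrite coef_sum; apply: eq_bigr => la _; rewrite coef_map_id0 ?scale0r. Qed.

Lemma symcf_p_sum_homogeneous n (c : intpart n -> rat) :
  homogeneous n (symcf (\sum_(mu : intpart n) c mu *: sym_p_part mu)).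
Proof.
move=> s sn; rewrite symcf_sum big1 // => mu _.
by rewrite p_part_homogeneous ?mulr0.
Qed.

(** Pairing with la reads off the coefficient of p_la up to the factor z_la, the other degrees
    contributing 0. This yields the uniqueness in [p_positive]. *)
Lemma p_expansion_coef F c : p_expansion F c -> forall d (la : intpart d) k,
  (c d la)`_k = (zpart la)%:R^-1 * pairing (parts la) (symcf F`_k).
Proof.
move=> [D cD ->] d la k; rewrite coef_sum; under eq_bigr do rewrite coef_p_sum.
under eq_bigr do rewrite -[\sum_ _ _]scale1r.
rewrite symcf_sum pairing_sum.
have zero (e : 'I_D) : e != d :> nat ->
    1 * pairing (parts la) (symcf (\sum_(mu : intpart e) (c e mu)`_k *: sym_p_part mu)) = 0.
  move=> ed; rewrite mul1r (pairing_homogeneous (symcf_p_sum_homogeneous _)) //.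
  by have [_ _ ->] := partsP la; rewrite eq_sym.
have [dD|dD] := ltnP d D; last first.
  rewrite big1 ?mulr0 ?cD ?coef0 // => e _; apply: zero.
  by rewrite neq_ltn (leq_trans (ltn_ord e)).
rewrite (bigD1 (Ordinal dD)) //= [X in _ + X]big1 ?addr0 => [|e ed]; last exact: zero.
by rewrite mul1r pairing_p_sum mulKf ?zpart_neq0.
Qed.

Lemma homogeneous_p_positive n (F : {poly symfun}) :
  (forall k, homogeneous n (symcf F`_k)) ->
  (forall k (la : intpart n), 0 <= pairing (parts la) (symcf F`_k)) ->
  p_positive F.
Proof.
move=> Fn F0.
pose c d (la : intpart d) :=
  \poly_(k < size F) ((zpart la)%:R^-1 * pairing (parts la) (symcf F`_k)).
have cE d la k : (c d la)`_k = (zpart la)%:R^-1 * pairing (parts la) (symcf F`_k).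
  rewrite coef_poly; case: ltnP => // kF; rewrite nth_default //.
  have -> : symcf 0 = fun=> 0 by apply/funext => s; rewrite /symcf rmorph0.
  by rewrite pairing_zero mulr0.
have c0 d (la : intpart d) : d != n -> c d la = 0.
  move=> dn; apply/polyP => k; rewrite cE coef0 (pairing_homogeneous (Fn k)) ?mulr0 //.
  by have [_ _ ->] := partsP la.
have Fc : p_expansion F c.
  exists n.+1 => [d la nd|]; first by rewrite c0 // gtn_eqF.
  apply/polyP => k; rewrite coef_sum big_ord_recr /= big1 ?add0r => [|d _].
    by rewrite coef_p_sum {1}(p_part_expansion (Fn k)); apply: eq_bigr => la _; rewrite cE.
  by rewrite coef_p_sum big1 // => la _; rewrite c0 ?coef0 ?scale0r // ltn_eqF.
exists c; split=> // [c' Fc' d la|d la k].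
  by apply/polyP => k; rewrite cE (p_expansion_coef Fc').
have [dn|dn] := eqVneq d n; last by rewrite c0 ?coef0.
by subst d; rewrite cE mulr_ge0 ?invr_ge0 ?ler0n.
Qed.

Theorem theorem5 (n : nat) (n_gt0 : (0 < n)%N)
    (E : rel 'I_n) (E_irr : irreflexive E)
    (X : {poly symfun}) (X_def : map_poly val X = chromatic_qsym E)
    (omega : {lrmorphism symfun -> symfun})
    (omega_e : forall k, omega (sym_e k) = sym_h k) :
  map_poly omega X =
    \sum_(la : intpart n)
       ((zpart la)%:R^-1 *: sym_p_part la)%:P *
       \sum_(s in Nset E la) 'X^(Ginv E s)
  /\ p_positive (map_poly omega X).
Proof.
have Xk k : symcf X`_k = evs (chromatic_qsym_coef E k).
  by rewrite -coef_chromatic -X_def coef_map.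
have Xs k : zsym (evs (chromatic_qsym_coef E k)) by rewrite -Xk; apply: symcf_zsym.
have omegaX k : (map_poly omega X)`_k = \sum_(la : intpart n)
    ((zpart la)%:R^-1 * #|[set t in Nset E la | Ginv E t == k]|%:R) *: sym_p_part la.
  rewrite coef_map /= (omega_expansion omega_e (n := n)) => [|s sn]; last first.
    by rewrite Xk chromatic_homogeneous.
  (* The sign from omega cancels the one from the pairing. *)
  apply: eq_bigr => la _; rewrite Xk pairing_chromatic //.
  by rewrite [psign _ * _]mulrA psign_sq mul1r.
split.
  apply/polyP => k; rewrite omegaX coef_sum; apply: eq_bigr => la _.
  rewrite coefCM coef_sum -sum1_card natr_sum mulr_sumr mulr_sumr scaler_suml.
  rewrite (eq_bigl (fun t => (t \in Nset E la) && (Ginv E t == k))) => [|t]; last by rewrite inE.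
  rewrite big_mkcondr /=; apply: eq_bigr => t _; rewrite coefXn eq_sym.
  by case: eqP; rewrite ?mulr1 ?mulr0.
apply: (@homogeneous_p_positive n) => k; first by rewrite omegaX; apply: symcf_p_sum_homogeneous.
by move=> la; rewrite omegaX pairing_p_sum mulr_ge0 ?ler0n // mulr_ge0 ?invr_ge0 ?ler0n.
Qed.
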